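(* There exists an absolute constant $C$ such that the following holds. Let $R$ be a graph of order $r \ge 2$, let $d$, $\delta$, $\Delta$ be positive parameters, and let $\varepsilon$ satisfy $$0 < \varepsilon < \left(\frac{\delta d^{\Delta}}{r\Delta}\right)^{C}.$$ Let $N$ be an arbitrary positive integer, and replace the vertices of $R$ with pairwise disjoint sets $V_1, V_2, \ldots, V_r$, each of size $N$. Construct two graphs on the same vertex set $V = \bigcup_{i=1}^r V_i$. The graph $R(N)$ is obtained by replacing every edge $\{i,j\}$ of $R$ with the complete bipartite graph $K_{N,N}$ between $V_i$ and $V_j$ (and there are no other edges). The graph $G$ is obtained by replacing every edge $\{i,j\}$ of $R$ with some $(\varepsilon, d, \delta)$-super-regular pair $(V_i, V_j)$ (and there are no other edges). If a graph $H$ with maximum degree $\Delta(H) \le \Delta$ is embeddable into $R(N)$, then $H$ is embeddable into $G$.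
   Context: All graphs are simple (no loops or multiple edges). The order of a graph is its number of vertices, and $\Delta(H)$ denotes the maximum degree of $H$. The vertices of $R$ are labelled $1, \ldots, r$, with vertex $i$ replaced by $V_i$. For disjoint vertex sets $X, Y$ in a graph, $e(X,Y)$ is the number of edges between $X$ and $Y$, and the density is $d(X,Y) = \frac{e(X,Y)}{|X|\cdot|Y|}$. For two disjoint subsets $A,B$ of the vertex set of a graph $G$, the pair $(A,B)$ is the bipartite graph with vertex set $A \cup B$ which has all the edges of $G$ with one endpoint in $A$ and the other in $B$. A pair $(A,B)$ is $\varepsilon$-regular if for every $X \subset A$ and $Y \subset B$ satisfying $|X| > \varepsilon|A|$ and $|Y| > \varepsilon|B|$ we have $|d(X,Y) - d(A,B)| < \varepsilon$. A pair $(A,B)$ is $(\varepsilon, d, \delta)$-super-regular if it is $\varepsilon$-regular, its density satisfies $d(A,B) \ge d$, and furthermore, with degrees taken in the bipartite graph $(A,B)$, $\deg(a) \ge \delta|B|$ for all $a \in A$ and $\deg(b) \ge \delta|A|$ for all $b \in B$. A graph $H$ is embeddable into a graph $G$ if $G$ has a subgraph isomorphic to $H$, i.e., if there is an injection $\varphi: V(H) \to V(G)$ such that $\{x,y\} \in E(H)$ implies $\{\varphi(x), \varphi(y)\} \in E(G)$. *)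

(* Defs.v *)
From mathcomp Require Import all_boot all_order all_algebra.
From mathcomp Require Import reals exp.

Set Implicit Arguments.
Unset Strict Implicit.
Unset Printing Implicit Defensive.

Import Order.TTheory GRing.Theory Num.Theory.
Local Open Scope ring_scope.

Definition simple_graph (T : finType) (E : rel T) : Prop :=
  symmetric E /\ irreflexive E.

Definition maxdeg (T : finType) (E : rel T) : nat :=
  (\max_(x : T) #|[set y | E x y]|)%N.

(* Counts ordered pairs in X * Y, hence each edge once when X and Y are
   disjoint, the only case in which it is used. *)
Definition edges_between (T : finType) (E : rel T) (X Y : {set T}) : nat :=
  #|[set p in setX X Y | E p.1 p.2]|.

Definition density (K : realType) (T : finType) (E : rel T) (X Y : {set T}) : K :=
  (edges_between E X Y)%:R / (#|X|%:R * #|Y|%:R).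

(* The pair (A, B) is not built as a separate bipartite graph: for X in A and
   Y in B its edges between X and Y are those of E. *)
Definition regular_pair (K : realType) (eps : K) (T : finType) (E : rel T)
    (A B : {set T}) : Prop :=
  forall X Y : {set T}, X \subset A -> Y \subset B ->
    eps * #|A|%:R < #|X|%:R -> eps * #|B|%:R < #|Y|%:R ->
    `|density K E X Y - density K E A B| < eps.

Definition super_regular_pair (K : realType) (eps d delta : K) (T : finType)
    (E : rel T) (A B : {set T}) : Prop :=
  [/\ regular_pair eps E A B,
      d <= density K E A B,
      (forall a, a \in A -> delta * #|B|%:R <= #|[set b in B | E a b]|%:R) &
      (forall b, b \in B -> delta * #|A|%:R <= #|[set a in A | E a b]|%:R)].

(* With pairwise disjoint parts V i of size N this is the graph R(N). *)
Definition blowup (r : nat) (R : rel 'I_r) (T : finType) (V : 'I_r -> {set T}) :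
    rel T :=
  fun x y => [exists i, exists j, [&& R i j, x \in V i & y \in V j]].

Definition embeddable (S T : finType) (H : rel S) (G : rel T) : Prop :=
  exists phi : S -> T,
    injective phi /\ (forall x y, H x y -> G (phi x) (phi y)).

(* Main.v *)
(** The vertices of H are embedded one at a time. Each vertex y carries a
    candidate set [cand y], the images compatible with the neighbours embedded
    before y, and the product [dens y] of the densities of the pairs involved.
    Regularity says that, for a fixed set X, all but few vertices v satisfy
    |X :&: N(v)| = density * |X| up to eps * N; so an image can be chosen for
    which the candidate sets shrink by the expected factors and the total
    deviation of the |cand y :&: cand y'| from dens y * dens y' * N grows
    slowly. By a second moment computation this bounds the discrepancy of the
    bipartite graph between a cluster and its candidates.

    An independent buffer B is kept for the end. The neighbours of B are
    embedded first, after which few vertices of G are candidates of too few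
    buffer vertices; the minimum degree condition allows one to cover these one
    by one. The other vertices are embedded outside a small reserve R0 whenever
    possible, and the discrepancy bound shows that few of them need the reserve.
    Finally Hall's theorem places the buffer: small sets are handled by the
    reserve, large ones by the discrepancy and by the covering step. All the
    thresholds are powers of a = delta * d ^ Delta / (r * Delta), which makes
    eps < a ^ 120 sufficient. *)
Require Import Defs.
From mathcomp Require Import all_boot all_order all_algebra.
From mathcomp Require Import reals exp.
From mathcomp Require Import ring lra zify.
Set Implicit Arguments.
Unset Strict Implicit.
Unset Printing Implicit Defensive.
Import Order.TTheory GRing.Theory Num.Theory.
Local Open Scope ring_scope.

(** * Hall's marriage theorem *)

Section Hall.
Variables S T : finType.

(** Induction on [#|B|]. If some nonempty proper [X] is tight, match [X] first and the rest outside
    its neighbourhood [W]. Otherwise every nonempty proper subset has a surplus of one, so any image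
    of a single [x0] can be given away. The [option] avoids the need of a default element of [T]. *)
Lemma hall_marriage (A : S -> {set T}) (B : {set S}) :
  (forall X : {set S}, X \subset B -> (#|X| <= #|\bigcup_(x in X) A x|)%N) ->
  exists m : S -> option T, {in B &, injective m} /\
    (forall x, x \in B -> exists2 v, v \in A x & m x = Some v).
Proof.
have [k] := ubnP #|B|; elim: k A B => // k IH A B ltBk hall.
have [->|[x0 x0B]] := set_0Vmem B.
  by exists (fun=> None); split=> [x y|x]; rewrite inE.
have [/existsP[X /and4P[sXB nX0 nXB /eqP cX]]|noX] :=
  boolP [exists X : {set S}, [&& X \subset B, X != set0, X != B &
      #|\bigcup_(x in X) A x| == #|X|]].
  have pXB : X \proper B by rewrite properEneq nXB.
  have ltX : (#|X| < k)%N by have := proper_card pXB; lia.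
  have ltY : (#|B :\: X| < k)%N.
    by rewrite cardsD (setIidPr sXB); move: nX0; rewrite -card_gt0; lia.
  have [Y sYX|m1 [inj1 m1A]] := IH A X ltX.
    by apply: hall; apply: subset_trans sXB.
  set W := \bigcup_(x in X) A x.
  have [Y sY|m2 [inj2 m2A]] := IH (fun x => A x :\: W) (B :\: X) ltY.
    have disYX : [disjoint Y & X].
      by move: sY; rewrite subsetD => /andP[_].
    have sYXB : Y :|: X \subset B.
      by rewrite subUset sXB andbT; apply: subset_trans sY (subsetDl _ _).
    have := hall _ sYXB; rewrite bigcup_setU -/W.
    have -> : #|Y :|: X| = (#|Y| + #|X|)%N.
      by rewrite cardsU (disjoint_setI0 disYX) cards0 subn0.
    have : (#|\bigcup_(x in Y) A x :|: W| <= #|\bigcup_(x in Y) (A x :\: W)| + #|W|)%N.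
      apply: leq_trans (leq_card_setU _ _); apply: subset_leq_card.
      apply/subsetP=> v; rewrite inE => /orP[/bigcupP[x xY vx]|vW]; last by rewrite inE vW orbT.
      rewrite inE; have [vW|nvW] := boolP (v \in W); first by rewrite ?vW orbT.
      by apply/orP; left; apply/bigcupP; exists x; rewrite // inE nvW.
    by rewrite cX; lia.
  exists (fun x => if x \in X then m1 x else m2 x); split=> [x y xB yB|x xB].
    have m12 z t : z \in X -> t \in B -> t \notin X -> m1 z <> m2 t.
      move=> zX tB ntX; have [v vA ->] := m1A _ zX.
      have [|w + ->] := m2A t; first by rewrite inE ntX.
      rewrite inE => /andP[/negP nwW _] [evw]; apply: nwW; rewrite -evw.
      by apply/bigcupP; exists z.
    case: ifPn => xX; case: ifPn => yX.
    - exact: inj1.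
    - by move/(m12 _ _ xX yB yX).
    - by move/esym/(m12 _ _ yX xB xX).
    - by apply: inj2; rewrite inE ?xX ?yX.
  case: ifPn => xX; first exact: m1A.
  have [|v] := m2A x; first by rewrite inE xX.
  by rewrite inE => /andP[_ vA] ->; exists v.
have cA0 : (0 < #|A x0|)%N.
  have := hall [set x0]; rewrite sub1set big_set1 cards1; exact.
have [v0 v0A] := card_gt0P cA0.
have ltB1 : (#|B :\ x0| < k)%N by move: ltBk; rewrite (cardsD1 x0) x0B; lia.
have [X sX|m [injm mA]] := IH (fun x => A x :\ v0) (B :\ x0) ltB1.
  have [->|nX0] := eqVneq X set0; first by rewrite cards0.
  have sXB : X \subset B by apply: subset_trans sX (subsetDl _ _).
  have nXB : X != B.
    by apply: contraTneq sX => ->; apply/subsetPn; exists x0; rewrite // !inE eqxx.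
  move: noX; rewrite negb_exists => /forallP/(_ X); rewrite sXB nX0 nXB /= => neq.
  have := hall _ sXB => le1.
  have lt1 : (#|X| < #|\bigcup_(x in X) A x|)%N by rewrite ltn_neqAle eq_sym neq.
  have : (#|(\bigcup_(x in X) A x) :\ v0| <= #|\bigcup_(x in X) (A x :\ v0)|)%N.
    apply: subset_leq_card; apply/subsetP=> v; rewrite !inE => /andP[nv /bigcupP[x xX vx]].
    by apply/bigcupP; exists x; rewrite // !inE nv.
  move: lt1; rewrite (cardsD1 v0 (\bigcup_(x in X) A x)); case: (_ \in _) => /=; lia.
exists (fun x => if x == x0 then Some v0 else m x); split=> [x y xB yB|x xB].
  have aux z : z \in B -> z != x0 -> Some v0 <> m z.
    move=> zB nz; have [|v + ->] := mA z; first by rewrite !inE nz.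
    by rewrite !inE => /andP[nv _] [ev]; rewrite ev eqxx in nv.
  case: eqVneq => [->|nx]; case: eqVneq => [->|ny] //.
  - by move/aux => /(_ yB ny).
  - by move/esym/aux => /(_ xB nx).
  - by apply: injm; rewrite !inE ?nx ?ny.
case: eqVneq => [->|nx]; first by exists v0.
have [|v] := mA x; first by rewrite !inE nx.
by rewrite !inE => /andP[_ vA] ->; exists v.
Qed.

End Hall.

(** * Clusters, partial embeddings and their invariant *)

Definition part (r : nat) (T : finType) (cl : T -> 'I_r) i := [set v | cl v == i].
Definition nb (T : finType) (E : rel T) v := [set w | E v w].

(* [H] is spanning and already lives on the vertex set of [G]; [dn i j] is the
   density of the pair of clusters (i, j), and [dm] is a lower bound for it. *)
Record blowup_setting (K : realFieldType) (r : nat) (T : finType) (cl : T -> 'I_r)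
    (N : nat) (G H : rel T) (R : rel 'I_r) (dn : 'I_r -> 'I_r -> K) (D : nat)
    (a eps dm : K) : Prop := Setting {
  card_part : forall i, #|part cl i| = N;
  G_sym : symmetric G;
  G_cl : forall v w, G v w -> cl v != cl w;
  H_sym : symmetric H;
  H_cl : forall x y, H x y -> cl x != cl y;
  H_R : forall x y, H x y -> R (cl x) (cl y);
  H_deg : forall x, (#|nb H x| <= D)%N;
  dn_ge : forall i j, R i j -> dm <= dn i j;
  dn_le1 : forall i j, R i j -> dn i j <= 1;
  typ_lo : forall i j (A : {set T}), R i j -> A \subset part cl j ->
    #|[set v in part cl i | #|A :&: nb G v|%:R < dn i j * #|A|%:R - eps * N%:R]|%:R
      <= eps * N%:R;
  typ_hi : forall i j (A : {set T}), R i j -> A \subset part cl j ->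
    #|[set v in part cl i | dn i j * #|A|%:R + eps * N%:R < #|A :&: nb G v|%:R]|%:R
      <= eps * N%:R;
  G_deg : forall v j, R (cl v) j -> a * N%:R <= #|part cl j :&: nb G v|%:R;
  dm_gt0 : 0 < dm;
  dm_le1 : dm <= 1;
  dm_exp : a <= dm ^+ D;
  a_gt0 : 0 < a;
  a_le : a <= 2%:R^-1;
  D_gt0 : (0 < D)%N;
  r_gt1 : (1 < r)%N;
  rDa : r%:R * D%:R * a <= 1;
  eps_gt0 : 0 < eps;
  eps_le : eps <= a ^+ 120;
  eps_n : 1 <= eps * N%:R
}.

(* [phi] is meaningful on [dom] only. [cand y], [dens y] and the number [emb y]
   of neighbours recorded in them are no longer updated once y is embedded. *)
Record state (K : Type) (T : finType) := State {
  dom : {set T};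
  phi : T -> T;
  cand : T -> {set T};
  dens : T -> K;
  emb : T -> nat
}.

Section Core.
Variables (K : realFieldType) (r : nat) (T : finType) (cl : T -> 'I_r) (N : nat).
Variables (G H : rel T) (R : rel 'I_r) (dn : 'I_r -> 'I_r -> K) (D : nat).
Variables (a eps dm : K).
Hypothesis hs : blowup_setting cl N G H R dn D a eps dm.
Local Notation n := (N%:R : K).
Local Notation part := (part cl).
Local Notation state := (state K T).
Local Notation c A := (#|(A : {set T})|%:R : K).
(** A square root of the bound [a ^+ 120] on [eps]: by Markov's inequality, an error of order [eps]
    on average exceeds order [eta] on at most an [eta] fraction of a cluster. *)
Let eta := a ^+ 60.

Definition defect (s : state) y y' : K :=
  `|c (cand s y :&: cand s y') - dens s y * dens s y' * n|.

Definition total_defect (s : state) : K := \sum_y \sum_(y' in part (cl y)) defect s y y'.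

Definition codegree_err (s : state) x v y y' : K :=
  `|c (cand s y :&: cand s y' :&: nb G v) - dn (cl x) (cl y) * c (cand s y :&: cand s y')|.

Definition todo (s : state) x := nb H x :\: dom s.

(** [U y] is a reserve of places for y, of which [inv_res] keeps roughly a proportion [dens s y]
    among the candidates. [inv_emb] is an inequality because the count stops once y is embedded. In
    [inv_defect] each embedded vertex pays twice the error allowed to a typical image, plus
    [D ^ 2 * n]. *)
Record inv (U : T -> {set T}) (s : state) : Prop := Inv {
  inv_inj : {in dom s &, injective (phi s)};
  inv_cl : forall x, x \in dom s -> cl (phi s x) = cl x;
  inv_hom : forall x y, x \in dom s -> y \in dom s -> H x y -> G (phi s x) (phi s y);
  inv_part : forall y, cand s y \subset part (cl y);
  inv_adj : forall x y v, x \in dom s -> y \notin dom s -> H x y ->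
    v \in cand s y -> G (phi s x) v;
  inv_emb : forall y, (emb s y <= #|nb H y :&: dom s|)%N;
  inv_dens : forall y, dm ^+ emb s y <= dens s y <= 1;
  inv_cand : forall y, dens s y * n - (emb s y)%:R * (eps * n) <= c (cand s y);
  inv_res : forall y, y \notin dom s ->
    dens s y * c (U y) - (emb s y)%:R * (eps * n) <= c (cand s y :&: U y);
  inv_fresh : forall y, nb H y :&: dom s = set0 -> cand s y = part (cl y) /\ dens s y = 1;
  inv_defect : total_defect s <= #|dom s|%:R * (6%:R * D%:R * eta * n ^+ 2 + D%:R ^+ 2 * n)
}.

Definition upd (s : state) x v : state := State
  (x |: dom s)
  (fun y => if y == x then v else phi s y)
  (fun y => if y \in todo s x then cand s y :&: nb G v else cand s y)
  (fun y => if y \in todo s x then dn (cl x) (cl y) * dens s y else dens s y)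
  (fun y => if y \in todo s x then (emb s y).+1 else emb s y).

(** The three conditions serve to preserve [inv_cand], [inv_res] and [inv_defect], in this order. *)
Definition typical_image (U : T -> {set T}) s x v : Prop :=
  [/\ forall y, y \in todo s x ->
        dn (cl x) (cl y) * c (cand s y) - eps * n <= c (cand s y :&: nb G v),
      forall y, y \in todo s x ->
        dn (cl x) (cl y) * c (cand s y :&: U y) - eps * n
          <= c (cand s y :&: nb G v :&: U y) &
      \sum_(y in todo s x) \sum_(y' in part (cl y)) codegree_err s x v y y'
        <= 3%:R * D%:R * eta * n ^+ 2].

Lemma n_ge0 : 0 <= n. Proof. exact: ler0n. Qed.

Lemma card_le_part (A : {set T}) i : A \subset part i -> c A <= n.
Proof. by move=> sA; rewrite ler_nat -(card_part hs i) subset_leq_card. Qed.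

Lemma H_irr x : H x x = false.
Proof. by apply/negP => /(H_cl hs); rewrite eqxx. Qed.

Lemma todoP s x y : y \in todo s x -> [/\ y \notin dom s, H x y & R (cl x) (cl y)].
Proof. by rewrite !inE => /andP[-> Hxy]; split=> //; exact: (H_R hs). Qed.

Lemma card_todo s x : (#|todo s x| <= D)%N.
Proof. by apply: leq_trans (H_deg hs x); rewrite subset_leq_card// subsetDl. Qed.

Lemma dn_ge0 i j : R i j -> 0 <= dn i j.
Proof. by move=> Rij; apply: le_trans (dn_ge hs Rij); apply: ltW; apply: dm_gt0 hs. Qed.

Lemma dens_ge0 U s y : inv U s -> 0 <= dens s y <= 1.
Proof.
move=> /inv_dens/(_ y)/andP[le1 ->]; rewrite andbT; apply: le_trans le1.
by rewrite exprn_ge0 // ltW // (dm_gt0 hs).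
Qed.

(* Pairs with one end in [todo s x] pay [codegree_err]; the at most D^2 pairs
   with both ends there are bounded trivially. *)
Lemma total_defect_upd U s x v : inv U s ->
  total_defect (upd s x v) <= total_defect s
    + 2%:R * (\sum_(y in todo s x) \sum_(y' in part (cl y)) codegree_err s x v y y')
    + D%:R ^+ 2 * n.
Proof.
move=> Is.
pose t y : K := (y \in todo s x)%:R.
pose e y y' := codegree_err s x v y y'.
have split_le y y' : y' \in part (cl y) ->
    defect (upd s x v) y y' <= defect s y y' + (t y * e y y' + t y' * e y' y + t y * t y' * n).
  rewrite inE => /eqP cyy'.
  have e0 z z' : 0 <= e z z' by exact: normr_ge0.
  have [/andP[p0 p1] /andP[q0 q1]] := (dens_ge0 y Is, dens_ge0 y' Is).
  have n0 := n_ge0.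
  rewrite /defect /upd /= /t.
  case: ifPn => [yt|_]; case: ifPn => [y't|_]; rewrite ?mul1r ?mul0r ?add0r ?addr0 //.
  - have [[_ _ Ry] [_ _ Ry']] := (todoP yt, todoP y't).
    rewrite cyy'.
    have [d0 d1] := (dn_ge0 Ry, dn_le1 hs Ry).
    set P := dn _ _ in d0 d1 *.
    have -> : P * dens s y * (P * dens s y') = P * P * (dens s y * dens s y') by ring.
    apply: (@le_trans _ _ n); last by rewrite !addrA lerDr !addr_ge0 ?normr_ge0.
      rewrite ler_norml; apply/andP; split.
        rewrite lerBrDr; apply: (@le_trans _ _ 0); last exact: ler0n.
        rewrite addrC subr_le0 -[leRHS]mul1r ler_wpM2r // mulr_ile1 ?mulr_ge0 //;
          by rewrite mulr_ile1 ?mulr_ge0.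
      rewrite lerBlDr -[leLHS]addr0 lerD //; last by rewrite !mulr_ge0.
      by apply: (@card_le_part _ (cl y)); rewrite -setIA subIset // (inv_part Is).
  - have [_ _ Ry] := todoP yt; have [d0 d1] := (dn_ge0 Ry, dn_le1 hs Ry).
    rewrite /e /codegree_err [cand s y :&: nb G v :&: _]setIAC.
    set P := dn _ _ in d0 d1 *; set X := c (_ :&: nb G v); set Y := c (_ :&: cand s y').
    have -> : X - P * dens s y * dens s y' * n =
       P * (Y - dens s y * dens s y' * n) + (X - P * Y) by ring.
    apply: le_trans (ler_normD _ _) _; rewrite lerD2r normrM ger0_norm //.
    by rewrite ler_piMl.
  - have [_ _ Ry] := todoP y't; have [d0 d1] := (dn_ge0 Ry, dn_le1 hs Ry).
    rewrite /e /codegree_err setIA [cand s y' :&: cand s y]setIC.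
    set P := dn _ _ in d0 d1 *; set X := c (_ :&: nb G v); set Y := c (_ :&: cand s y').
    have -> : X - dens s y * (P * dens s y') * n =
       P * (Y - dens s y * dens s y' * n) + (X - P * Y) by ring.
    apply: le_trans (ler_normD _ _) _; rewrite lerD2r normrM ger0_norm //.
    by rewrite ler_piMl.
have H1 : \sum_y \sum_(y' in part (cl y)) t y * e y y' =
    \sum_(y in todo s x) \sum_(y' in part (cl y)) codegree_err s x v y y'.
  rewrite [RHS]big_mkcond; apply: eq_bigr => y _; rewrite /t.
  case: (y \in _); first by apply: eq_bigr => y' _; rewrite mul1r.
  by rewrite big1 // => y' _; rewrite mul0r.
(* By symmetry both orders of a pair cost the same, whence the factor 2. *)
have H2 : \sum_y \sum_(y' in part (cl y)) t y' * e y' y =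
    \sum_y \sum_(y' in part (cl y)) t y * e y y'.
  rewrite [RHS](exchange_big_dep predT) //=; apply: eq_bigr => y _.
  by apply: eq_bigl => y'; rewrite !inE eq_sym.
have H3 : \sum_y \sum_(y' in part (cl y)) t y * t y' * n <= D%:R ^+ 2 * n.
  have t0 z : 0 <= t z by exact: ler0n.
  apply: (@le_trans _ _ (\sum_y \sum_y' t y * t y' * n)).
    apply: ler_sum => y _; rewrite big_mkcond; apply: ler_sum => y' _.
    by case: ifP => // _; rewrite !mulr_ge0 ?n_ge0.
  have -> : \sum_y \sum_y' t y * t y' * n = (\sum_y t y) ^+ 2 * n.
    rewrite expr2 mulr_suml mulr_suml; apply: eq_bigr => y _.
    by rewrite mulr_sumr mulr_suml.
  rewrite ler_wpM2r ?n_ge0 // lerXn2r ?nnegrE ?sumr_ge0 ?ler0n //.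
  by rewrite /t -natr_sum -big_mkcond /= sum1_card ler_nat card_todo.
apply: (@le_trans _ _ (\sum_y \sum_(y' in part (cl y))
   (defect s y y' + (t y * e y y' + t y' * e y' y + t y * t y' * n)))).
  by apply: ler_sum => y _; apply: ler_sum => y' yy'; apply: split_le.
under eq_bigr do rewrite !big_split /=.
rewrite !big_split /= H2 H1 /total_defect.
move: H3; set X := \sum_y _; set Y := \sum_(y in _) _; set Z := \sum_y _; lra.
Qed.

(* When [todo s x] is empty the typicality hypothesis is void, so that an image
   can then be imposed. *)
Lemma inv_upd U s x v : inv U s -> x \notin dom s -> typical_image U s x v ->
    (forall z, z \in dom s -> phi s z != v) -> cl v = cl x ->
    (forall y, y \in dom s -> H y x -> G (phi s y) v) ->
  inv U (upd s x v).
Proof.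
move=> Is xnd [g1 g2 g3] vfree clv vadj; have eps0 : 0 <= eps * n.
  by rewrite mulr_ge0 ?n_ge0 // ltW // (eps_gt0 hs).
have nx y : y \in dom s -> (y == x) = false.
  by move=> yd; apply/negbTE; apply: contraNneq xnd => <-.
have Hdefect : total_defect (upd s x v)
    <= #|x |: dom s|%:R * (6%:R * D%:R * eta * n ^+ 2 + D%:R ^+ 2 * n).
  apply: le_trans (total_defect_upd x v Is) _.
  have -> : #|x |: dom s|%:R = 1 + c (dom s) by rewrite cardsU1 xnd natrD.
  rewrite [leRHS]mulrDl mul1r.
  move: (inv_defect Is) g3; set Z := c (dom s) * _; move=> le1 le2; lra.
split=> /=.
- move=> y z; rewrite !inE; case: eqP => [->|_] /= yd; case: eqP => [->|_] //= zd.
  + by move/esym/eqP; rewrite (negbTE (vfree _ zd)).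
  + by move/eqP; rewrite (negbTE (vfree _ yd)).
  + exact: inv_inj Is _ _ yd zd.
- move=> y; rewrite !inE; case: eqP => [->|_] //= yd; exact: inv_cl Is _ yd.
- move=> y z; rewrite !inE; case: eqP => [->|_] /= yd; case: eqP => [->|_] //= zd.
  + by rewrite H_irr.
  + by rewrite (H_sym hs) (G_sym hs); apply: vadj.
  + exact: vadj.
  + exact: inv_hom Is _ _ yd zd.
- move=> y; case: ifP => _; last exact: inv_part Is y.
  by apply: subset_trans (subsetIl _ _) (inv_part Is y).
- move=> y z w; rewrite !inE negb_or => yd /andP[znx znd] Hyz.
  move: yd; case: eqVneq => [eyx|_] /= yd.
    by rewrite eyx in Hyz; rewrite znd Hyz /= !inE => /andP[].
  move=> wC; apply: inv_adj Is _ _ _ yd znd Hyz _.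
  by move: wC; case: ifP => //; rewrite inE => _ /andP[].
- move=> y; case: ifPn => [/todoP[ynd Hxy _]|_].
    have -> : nb H y :&: (x |: dom s) = x |: (nb H y :&: dom s).
      by apply/setP=> z; rewrite !inE; case: eqP => //= ->; rewrite (H_sym hs) Hxy.
    by rewrite cardsU1 !inE (negbTE xnd) andbF add1n ltnS (inv_emb Is).
  by apply: leq_trans (inv_emb Is y) _; rewrite subset_leq_card // setIS // subsetUr.
- move=> y; have /andP[l1 l2] := inv_dens Is y; case: ifPn => [/todoP[_ _ Ry]|_]; last by rewrite l1.
  have dm0 := ltW (dm_gt0 hs); have [p0 p1] := andP (dens_ge0 y Is).
  apply/andP; split; last by rewrite mulr_ile1 ?dn_ge0 ?(dn_le1 hs).
  by rewrite exprS ler_pM ?exprn_ge0 ?(dn_ge hs).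
- move=> y; have le1 := inv_cand Is y; case: ifPn => [yt|_] //.
  have [_ _ Ry] := todoP yt; have [d0 d1] := (dn_ge0 Ry, dn_le1 hs Ry).
  apply: le_trans (g1 _ yt); rewrite -addn1 natrD mulrDl mul1r opprD addrA lerD2r.
  apply: (@le_trans _ _ (dn (cl x) (cl y) * (dens s y * n - (emb s y)%:R * (eps * n)))).
    by rewrite mulrBr -mulrA lerD2l lerN2 ler_piMl // mulr_ge0 ?ler0n.
  by rewrite ler_wpM2l.
- move=> y; rewrite !inE negb_or => /andP[_ ynd]; have le1 := inv_res Is ynd.
  rewrite ynd /=; case: ifPn => [Hxy|_] //.
  have yt : y \in todo s x by rewrite !inE ynd.
  have [_ _ Ry] := todoP yt; have [d0 d1] := (dn_ge0 Ry, dn_le1 hs Ry).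
  apply: le_trans (g2 _ yt); rewrite -addn1 natrD mulrDl mul1r opprD addrA lerD2r.
  apply: (@le_trans _ _ (dn (cl x) (cl y) * (dens s y * c (U y) - (emb s y)%:R * (eps * n)))).
    by rewrite mulrBr -mulrA lerD2l lerN2 ler_piMl // mulr_ge0 ?ler0n.
  by rewrite ler_wpM2l.
- move=> y y0; have ynt : (y \in todo s x) = false.
    apply/negP => /todoP[_ Hxy _].
    have : x \in nb H y :&: (x |: dom s) by rewrite !inE eqxx (H_sym hs) Hxy.
    by rewrite y0 inE.
  rewrite ynt; apply: inv_fresh Is _ _; apply/eqP; rewrite -subset0 -y0.
  by rewrite setIS // subsetUr.
- exact: Hdefect.
Qed.

(** * Numerical bounds on the parameters *)

Lemma apow_gt0 k : 0 < a ^+ k.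
Proof. by rewrite exprn_gt0 ?(a_gt0 hs). Qed.

Lemma apow_le k m : (k <= m)%N -> a ^+ m <= a ^+ k.
Proof.
have [a0 a1] := (a_gt0 hs, a_le hs).
by move=> km; apply: ler_wiXn2l => //; lra.
Qed.

(** Since [2 * a <= 1], each spare factor [a] absorbs a factor 2. Thresholds are compared in this
    way throughout. *)
Lemma apow_scale j k m : (k + j <= m)%N -> (2 ^ j)%:R * a ^+ m <= a ^+ k.
Proof.
move=> km; apply: (@le_trans _ _ ((2 ^ j)%:R * a ^+ (k + j))).
  by rewrite ler_wpM2l ?ler0n // apow_le.
rewrite natrX addnC exprD mulrA -exprMn; apply: ler_piMl; first exact: ltW (apow_gt0 _).
apply: exprn_ile1.
  by rewrite mulr_ge0 // ltW // (a_gt0 hs).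
by have := a_le hs; lra.
Qed.

Lemma D_ge1 : 1 <= D%:R :> K.
Proof. by rewrite ler1n (D_gt0 hs). Qed.

Lemma r_ge2 : 2 <= r%:R :> K.
Proof. by rewrite ler_nat (r_gt1 hs). Qed.

Lemma ra_le1 : r%:R * a <= 1.
Proof.
apply: le_trans (rDa hs); rewrite mulrAC ler_peMr ?D_ge1 //.
by rewrite mulr_ge0 ?ler0n // ltW // (a_gt0 hs).
Qed.

Lemma Da_le : D%:R * a <= 2%:R^-1.
Proof.
have D1 := D_ge1; have a0 := a_gt0 hs; have r2 := r_ge2.
have : 2%:R * (D%:R * a) <= r%:R * (D%:R * a) by rewrite ler_wpM2r // mulr_ge0 ?ler0n // ltW.
by have := rDa hs; rewrite -mulrA; lra.
Qed.

Lemma Deps : D%:R * eps <= a ^+ 119.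
Proof.
apply: (@le_trans _ _ (D%:R * a * a ^+ 119)).
  by rewrite -mulrA -exprS ler_wpM2l ?ler0n // (eps_le hs).
by have := Da_le; have := apow_gt0 119; nra.
Qed.

Lemma n_gt0 : 0 < n.
Proof.
rewrite lt0r ler0n andbT; have := eps_n hs.
by apply: contraTneq => ->; rewrite mulr0 ler10.
Qed.

Lemma epsn_ge0 : 0 <= eps * n.
Proof. by apply: le_trans (eps_n hs). Qed.

(** A density is bounded below by a product of at most [D] factors [dm], and [a <= dm ^+ D]. *)
Lemma dens_ge U s y : inv U s -> a <= dens s y.
Proof.
move=> Is; have /andP[+ _] := inv_dens Is y; apply: le_trans.
apply: le_trans (dm_exp hs) _; apply: ler_wiXn2l.
- exact: ltW (dm_gt0 hs).
- exact: dm_le1 hs.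
- apply: leq_trans (inv_emb Is y) _; apply: leq_trans (H_deg hs y).
  by rewrite subset_leq_card // subsetIl.
Qed.

Lemma emb_le U s y : inv U s -> (emb s y)%:R * (eps * n) <= a ^+ 119 * n.
Proof.
move=> Is; rewrite mulrA ler_wpM2r ?ler0n //; apply: le_trans Deps.
rewrite ler_wpM2r //; first exact: ltW (eps_gt0 hs).
rewrite ler_nat; apply: leq_trans (inv_emb Is y) _; apply: leq_trans (H_deg hs y).
by rewrite subset_leq_card // subsetIl.
Qed.

Lemma card_bigcup_le (I S : finType) (P : pred I) (F : I -> {set S}) :
  (#|\bigcup_(i | P i) F i| <= \sum_(i | P i) #|F i|)%N.
Proof.
elim/big_rec2: _ => [|i m A _ le1]; first by rewrite cards0.
by apply: leq_trans (leq_card_setU _ _) _; rewrite leq_add2l.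
Qed.

(** * Choosing a typical image *)

Definition low_images x (A : {set T}) y :=
  [set v in part (cl x) | c (A :&: nb G v) < dn (cl x) (cl y) * c A - eps * n].

Definition skew_images s x : {set T} := [set v in part (cl x) |
  3%:R * D%:R * eta * n ^+ 2 < \sum_(y in todo s x) \sum_(y' in part (cl y)) codegree_err s x v y y'].

(** A deviation is at most [eps * n], except for the at most [eps * n] low and [eps * n] high
    vertices, where it is at most [n]. *)
Lemma sum_deviation x y (X : {set T}) : R (cl x) (cl y) -> X \subset part (cl y) ->
  \sum_(v in part (cl x)) `|c (X :&: nb G v) - dn (cl x) (cl y) * c X| <= 3%:R * eps * n ^+ 2.
Proof.
move=> Rxy sX; have n0 := ler0n K N; have en := epsn_ge0.
pose hi := [set v in part (cl x) | dn (cl x) (cl y) * c X + eps * n < c (X :&: nb G v)].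
have cX := card_le_part sX; have X0 := ler0n K #|X|.
have [d0 d1] := (dn_ge0 Rxy, dn_le1 hs Rxy).
apply: (@le_trans _ _ (\sum_(v in part (cl x))
    (eps * n + (v \in low_images x X y)%:R * n + (v \in hi)%:R * n))).
  apply: ler_sum => v vx; rewrite !inE; rewrite inE in vx; rewrite vx /=.
  have Y0 := ler0n K #|X :&: nb G v|.
  have Yn : c (X :&: nb G v) <= n by apply: (@card_le_part _ (cl y)); rewrite subIset ?sX.
  have Zn : dn (cl x) (cl y) * c X <= n by nra.
  have Z0 : 0 <= dn (cl x) (cl y) * c X by rewrite mulr_ge0.
  move: Y0 Yn Zn Z0; set Y := c (_ :&: _); set Z := _ * c X => Y0 Yn Zn Z0.
  rewrite ler_norml.
  by case: ltP => h1; case: ltP => h2; rewrite ?mul1r ?mul0r; apply/andP; split; lra.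
have count (B : {set T}) : B \subset part (cl x) ->
    \sum_(v in part (cl x)) (v \in B)%:R * n = c B * n.
  move=> sB; rewrite -mulr_suml; congr (_ * _); rewrite -natr_sum; congr (_%:R).
  rewrite -sum1_card [RHS]big_mkcond [LHS]big_mkcond /=; apply: eq_bigr => v _.
  by have := subsetP sB v; case: (v \in part _); case: (v \in B) => //= /(_ isT).
rewrite !big_split /= sumr_const (card_part hs) !count; try by apply/subsetP => v; rewrite inE => /andP[].
have := typ_lo hs Rxy sX; have := typ_hi hs Rxy sX.
rewrite -/(low_images x X y) -/hi; set L := c (low_images _ _ _); set U := c hi => h1 h2.
rewrite -mulr_natr; nra.
Qed.

(** Markov's inequality: by [sum_deviation] the errors of all v sum to at most
    [3 * D * eps * n ^ 3], and [eps <= eta ^+ 2]. *)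
Lemma card_skew U s x : inv U s -> c (skew_images s x) <= eta * n.
Proof.
move=> Is; have n0 := n_gt0; have eta0 : 0 < eta by exact: apow_gt0.
have D1 := D_ge1; have [e0 a0] := (eps_gt0 hs, a_gt0 hs).
pose e v := \sum_(y in todo s x) \sum_(y' in part (cl y)) codegree_err s x v y y'.
have le1 : c (skew_images s x) * (3%:R * D%:R * eta * n ^+ 2) <= \sum_(v in part (cl x)) e v.
  rewrite -sum1_card natr_sum mulr_suml.
  apply: (@le_trans _ _ (\sum_(v in skew_images s x) e v)).
    by apply: ler_sum => v; rewrite inE mul1r => /andP[_ /ltW].
  rewrite big_mkcond [leRHS]big_mkcond; apply: ler_sum => v _.
  have ev : 0 <= e v by do 2 (apply: sumr_ge0 => ? _); apply: normr_ge0.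
  by case: ifP => [|_]; [rewrite inE => /andP[-> _]|case: ifP].
have le2 : \sum_(v in part (cl x)) e v <= D%:R * (n * (3%:R * eps * n ^+ 2)).
  rewrite exchange_big /=.
  apply: (@le_trans _ _ (\sum_(y in todo s x) (n * (3%:R * eps * n ^+ 2)))).
    apply: ler_sum => y yt; have [_ _ Ry] := todoP yt.
    rewrite exchange_big /= -{1}(card_part hs (cl y)) mulr_natl -sumr_const.
    apply: ler_sum => y' _; apply: sum_deviation => //.
    by rewrite subIset // (inv_part Is).
  rewrite sumr_const -[leLHS]mulr_natl; apply: ler_wpM2r; last by rewrite ler_nat card_todo.
  by rewrite !mulr_ge0 ?exprn_ge0 // ltW.
have le3 : eps <= eta ^+ 2 by rewrite -exprM; exact: eps_le hs.
have le4 := le_trans le1 le2.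
have P0 : 0 < 3%:R * D%:R * eta * n ^+ 2 by rewrite !mulr_gt0 ?exprn_gt0 //; lra.
rewrite -(ler_pM2r P0); apply: le_trans le4 _.
have -> : D%:R * (n * (3 * eps * n ^+ 2)) = 3 * D%:R * n ^+ 3 * eps by ring.
have -> : eta * n * (3 * D%:R * eta * n ^+ 2) = 3 * D%:R * n ^+ 3 * eta ^+ 2 by ring.
by rewrite ler_wpM2l // !mulr_ge0 ?exprn_ge0 ?ltW //; lra.
Qed.

(** The images to avoid are those of low degree into a candidate set or its reserve part, at most
    [2 * a ^ 119 * n] by [typ_lo], and the skew ones, at most [eta * n]. Together they cannot fill
    [A]. *)
Lemma embed_step U s x (A : {set T}) : inv U s -> x \notin dom s -> A \subset cand s x ->
    [disjoint A & phi s @: dom s] -> a ^+ 50 * n < c A ->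
  exists2 v, v \in A & inv U (upd s x v).
Proof.
move=> Is xnd sA disA ltA; have n0 := n_gt0.
pose B1 := \bigcup_(y in todo s x) (low_images x (cand s y) y :|: low_images x (cand s y :&: U y) y).
have le1 : c B1 <= 2%:R * a ^+ 119 * n.
  apply: (@le_trans _ _ (\sum_(y in todo s x) 2%:R * (eps * n))).
    apply: (@le_trans _ _ (\sum_(y in todo s x)
       c (low_images x (cand s y) y :|: low_images x (cand s y :&: U y) y))).
      by rewrite -natr_sum ler_nat card_bigcup_le.
    apply: ler_sum => y yt; have [_ _ Ry] := todoP yt.
    apply: (@le_trans _ _ (c (low_images x (cand s y) y) + c (low_images x (cand s y :&: U y) y))).
      by rewrite -natrD ler_nat leq_card_setU.
    have sC := inv_part Is y; have sCU : cand s y :&: U y \subset part (cl y) by rewrite subIset ?sC.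
    by have := typ_lo hs Ry sC; have := typ_lo hs Ry sCU; rewrite -/(low_images x _ y) -/(low_images x _ y); lra.
  rewrite sumr_const -[leLHS]mulr_natl mulrCA -mulrA ler_wpM2l // mulrA ler_wpM2r //.
  apply: le_trans Deps; rewrite ler_wpM2r //; first exact: ltW (eps_gt0 hs).
  by rewrite ler_nat card_todo.
have le2 := card_skew x Is.
have nsub : ~~ (A \subset B1 :|: skew_images s x).
  apply/negP => /subset_leq_card sAB; move: ltA; apply/negP; rewrite -leNgt.
  apply: (@le_trans _ _ (c B1 + c (skew_images s x))).
    by rewrite -natrD ler_nat; apply: leq_trans sAB (leq_card_setU _ _).
  apply: (le_trans (lerD le1 le2)); rewrite -mulrDl ler_wpM2r ?(ltW n0) //.
  have h1 : 4%:R * a ^+ 119 <= a ^+ 50 := @apow_scale 2 50 119 isT.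
  have h2 : 2%:R * a ^+ 60 <= a ^+ 50 := @apow_scale 1 50 60 isT.
  move: h1 h2; rewrite /eta; set A1 := a ^+ 119; set A2 := a ^+ 60; set A3 := a ^+ 50.
  lra.
have [v vA vn] := subsetPn nsub; exists v => //.
move: vn; rewrite inE negb_or => /andP[vB vs].
have clv : cl v = cl x.
  by apply/eqP; have := subsetP (inv_part Is x) v (subsetP sA v vA); rewrite inE.
apply: inv_upd => //.
- split.
  + move=> y yt; rewrite leNgt; apply: contra vB => lt1; apply/bigcupP; exists y => //.
    by rewrite inE; apply/orP; left; rewrite !inE clv eqxx.
  + move=> y yt; rewrite leNgt; apply: contra vB => lt1; apply/bigcupP; exists y => //.
    by rewrite inE; apply/orP; right; rewrite !inE clv eqxx setIAC.
  + by rewrite leNgt; apply: contra vs => lt1; rewrite inE inE clv eqxx.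
- move=> z zd; apply: contraTneq vA => ez; apply/negP => vA.
  by move: disA; rewrite disjoint_subset => /subsetP/(_ v vA)/negP; apply; rewrite -ez imset_f.
- by move=> y yd Hyx; apply: inv_adj Is _ _ _ yd xnd Hyx _; apply: (subsetP sA).
Qed.

(** * The second moment and the discrepancy of the candidate graph *)

Lemma total_defect_le U s : inv U s -> total_defect s + 2%:R * (D%:R * eps) * n ^+ 3 <= a ^+ 50 * n ^+ 3.
Proof.
move=> Is; have n0 := ltW n_gt0; have eta0 : 0 <= eta := ltW (apow_gt0 60); have D1 := D_ge1; have [r2 ra] := (r_ge2, ra_le1).
have [a0 [Da De]] := (a_gt0 hs, (Da_le, Deps)).
have domn : c (dom s) <= r%:R * n.
  rewrite -natrM ler_nat -[X in (_ <= X * _)%N]card_ord -sum_nat_const.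
  apply: (@leq_trans #|[set: T]|); first by rewrite subset_leq_card // subsetT.
  have -> : [set: T] = \bigcup_(i in 'I_r) part i.
    by apply/setP => v; rewrite inE; apply/esym/bigcupP; exists (cl v); rewrite ?inE.
  by apply: leq_trans (card_bigcup_le _ _) _; apply: leq_sum => i _; rewrite (card_part hs).
have Q0 : 0 <= 6%:R * D%:R * eta * n ^+ 2 + D%:R ^+ 2 * n.
  by rewrite addr_ge0 // !mulr_ge0 ?exprn_ge0 ?ler0n ?(ltW a0).
have le1 := le_trans (inv_defect Is) (ler_wpM2r Q0 domn).
apply: (@le_trans _ _ (r%:R * n * (6 * D%:R * eta * n ^+ 2 + D%:R ^+ 2 * n)
    + 2 * (D%:R * eps) * n ^+ 3)).
  by rewrite lerD2r.
(* The hypothesis [1 <= eps * n] turns the linear term into a quadratic one with a factor [eps]. *)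
have le2 : D%:R ^+ 2 * n <= D%:R ^+ 2 * eps * n ^+ 2.
  rewrite -mulrA ler_wpM2l ?exprn_ge0 ?ler0n // expr2 mulrA ler_peMl //; exact: eps_n hs.
apply: (@le_trans _ _ (r%:R * n * (6 * D%:R * eta * n ^+ 2 + D%:R ^+ 2 * eps * n ^+ 2)
    + 2 * (D%:R * eps) * n ^+ 3)).
  by rewrite lerD2r ler_wpM2l ?lerD2l // mulr_ge0 ?ler0n.
have -> : r%:R * n * (6 * D%:R * eta * n ^+ 2 + D%:R ^+ 2 * eps * n ^+ 2)
    + 2 * (D%:R * eps) * n ^+ 3 =
  (6 * (r%:R * D%:R * eta) + r%:R * D%:R * (D%:R * eps) + 2 * (D%:R * eps)) * n ^+ 3 by ring.
rewrite ler_wpM2r ?exprn_ge0 //.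
have le3 : r%:R * D%:R * eta <= a ^+ 59.
  by rewrite /eta exprS mulrA; apply: ler_piMl; [exact: ltW (apow_gt0 _)|exact: rDa hs].
have le4 : r%:R * D%:R * (D%:R * eps) <= a ^+ 118.
  apply: (@le_trans _ _ (r%:R * D%:R * a ^+ 119)).
    by rewrite ler_wpM2l // mulr_ge0 ?ler0n.
  by rewrite exprS mulrA; apply: ler_piMl; [exact: ltW (apow_gt0 _)|exact: rDa hs].
have h1 : 16%:R * a ^+ 59 <= a ^+ 50 := @apow_scale 4 50 59 isT.
have h2 : 16%:R * a ^+ 118 <= a ^+ 50 := @apow_scale 4 50 118 isT.
have h3 : 16%:R * a ^+ 119 <= a ^+ 50 := @apow_scale 4 50 119 isT.
move: Deps le3 le4; set X := D%:R * eps; set Y := _ * eta; set Z := _ * X.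
have := apow_gt0 50; lra.
Qed.

(* Second moment method for v |-> \sum_(y in S) (dens y - (v \in cand y)). *)
Lemma discrepancy U s j (S Z : {set T}) : inv U s -> S \subset part j -> Z \subset part j ->
  \sum_(y in S) (dens s y * c Z - c (cand s y :&: Z)) <= a ^+ 25 * n ^+ 2.
Proof.
move=> Is sS sZ; have n0 := n_gt0; set t := a ^+ 25; have t0 : 0 < t by exact: apow_gt0.
pose g v : K := \sum_(y in S) (dens s y - (v \in cand s y)%:R).
have sumI (A B : {set T}) : \sum_(v in A) (v \in B)%:R = c (A :&: B) :> K.
  rewrite -natr_sum -sum1_card; congr (_%:R); rewrite big_mkcond [RHS]big_mkcond /=.
  by apply: eq_bigr => v _; rewrite inE; case: (v \in A) => //=; case: (v \in B).
have -> : \sum_(y in S) (dens s y * c Z - c (cand s y :&: Z)) = \sum_(v in Z) g v.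
  rewrite exchange_big; apply: eq_bigr => y _.
  by rewrite big_split /= sumr_const sumrN sumI setIC mulr_natr.
(* Expanding the square, a pair y, y' contributes the size of the common candidate set minus its
   expected size, up to the errors in the sizes of the two candidate sets: at most the defect plus
   [2 * D * eps * n]. *)
have sq : \sum_(v in part j) g v ^+ 2 <= t ^+ 2 * n ^+ 3.
  apply: (@le_trans _ _ (\sum_(y in S) \sum_(y' in S) (defect s y y' + 2%:R * (D%:R * eps) * n))).
    have -> : \sum_(v in part j) g v ^+ 2 =
       \sum_(y in S) \sum_(y' in S) \sum_(v in part j)
         (dens s y - (v \in cand s y)%:R) * (dens s y' - (v \in cand s y')%:R).
      rewrite [RHS](eq_bigr _ (fun y _ => exchange_big _ _ _ _ _ _)) exchange_big /=.
      by apply: eq_bigr => v _; rewrite expr2 mulr_suml; apply: eq_bigr => y _; rewrite mulr_sumr.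
    apply: ler_sum => y yS; apply: ler_sum => y' y'S.
    have cly : cl y = j by apply/eqP; have := subsetP sS y yS; rewrite inE.
    have cly' : cl y' = j by apply/eqP; have := subsetP sS y' y'S; rewrite inE.
    have sC : cand s y \subset part j by rewrite -cly (inv_part Is).
    have sC' : cand s y' \subset part j by rewrite -cly' (inv_part Is).
    have -> : \sum_(v in part j) (dens s y - (v \in cand s y)%:R) * (dens s y' - (v \in cand s y')%:R) =
       dens s y * dens s y' * n - dens s y * c (cand s y') - dens s y' * c (cand s y)
        + c (cand s y :&: cand s y').
      have sCC : cand s y :&: cand s y' \subset part j by rewrite subIset ?sC.
      have e (X : {set T}) : X \subset part j -> c X = \sum_(v in part j) (v \in X)%:R.
        by move=> sX; rewrite sumI (setIidPr sX).
      rewrite (e _ sC) (e _ sC') (e _ sCC).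
      rewrite -(card_part hs j) -sum1_card natr_sum !mulr_sumr -!sumrB -big_split /=.
      by apply: eq_bigr => v _; rewrite inE; case: (v \in _); case: (v \in _) => /=; ring.
    have [/andP[p0 p1] /andP[q0 q1]] := (dens_ge0 y Is, dens_ge0 y' Is).
    have cand_ge z : dens s z * n - D%:R * eps * n <= c (cand s z).
      apply: le_trans (inv_cand Is z); rewrite lerD2l lerN2 mulrA.
      rewrite ler_wpM2r ?(ltW n0) // ler_wpM2r ?(ltW (eps_gt0 hs)) // ler_nat.
      apply: leq_trans (inv_emb Is z) _; apply: leq_trans (H_deg hs z).
      by rewrite subset_leq_card // subsetIl.
    have h1 := ler_wpM2l q0 (cand_ge y); have h2 := ler_wpM2l p0 (cand_ge y').
    have De0 : 0 <= D%:R * eps * n by rewrite !mulr_ge0 ?ler0n ?(ltW (eps_gt0 hs)) ?(ltW n0).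
    have h3 := ler_wpM2r De0 p1; have h4 := ler_wpM2r De0 q1.
    have := ler_norm (c (cand s y :&: cand s y') - dens s y * dens s y' * n).
    rewrite -/(defect s y y'); move: h1 h2 h3 h4; set X := c (cand s y); set Y := c (cand s y').
    set p := dens s y; set q := dens s y'; set d := defect _ _ _; set w := c _; nra.
  have cS := card_le_part sS.
  rewrite /t -exprM; apply: le_trans (total_defect_le Is); under eq_bigr do rewrite big_split /=.
  rewrite big_split /=; apply: lerD.
    rewrite [leRHS](bigID (mem S)) /= -[leLHS]addr0; apply: lerD; last first.
      by apply: sumr_ge0 => y _; apply: sumr_ge0 => y' _; apply: normr_ge0.
    apply: ler_sum => y yS; rewrite [leRHS](bigID (mem S)) /= -[leLHS]addr0; apply: lerD; last first.
      by apply: sumr_ge0 => y' _; apply: normr_ge0.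
    rewrite le_eqVlt; apply/orP; left; apply/eqP; apply: eq_bigl => y'.
    case yS' : (y' \in S); last by rewrite andbF.
    have := subsetP sS y yS; have := subsetP sS y' yS'; rewrite !inE => /eqP-> /eqP->.
    by rewrite eqxx.
  set w := D%:R * eps; rewrite !sumr_const -[leLHS]mulr_natl -[X in _ * X <= _]mulr_natl.
  have w0 : 0 <= w by rewrite mulr_ge0 ?ler0n ?(ltW (eps_gt0 hs)).
  clearbody w; rewrite (_ : 2 * w * n ^+ 3 = n * (n * (2 * w * n))); last by ring.
  have w1 : 0 <= 2 * w * n by rewrite !mulr_ge0 ?ler0n.
  by apply: ler_pM; rewrite ?ler_wpM2r ?mulr_ge0 ?ler0n.
(* Uses [2 * (t * n) * g v <= g v ^ 2 + (t * n) ^ 2] for each v in place of the Cauchy-Schwarz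
   inequality. *)
have le1 : 2%:R * t * n * \sum_(v in Z) g v <= 2%:R * t * n * (t * n ^+ 2).
  have cZ := card_le_part sZ.
  apply: (@le_trans _ _ (\sum_(v in Z) (g v ^+ 2 + t ^+ 2 * n ^+ 2))).
    rewrite mulr_sumr; apply: ler_sum => v _.
    by have := sqr_ge0 (g v - t * n); rewrite !expr2; nra.
  rewrite big_split /= sumr_const -[X in _ + X]mulr_natl.
  apply: (@le_trans _ _ (t ^+ 2 * n ^+ 3 + n * (t ^+ 2 * n ^+ 2))).
    apply: lerD.
      apply: le_trans sq; rewrite [leRHS](bigID (mem Z)) /= -[leLHS]addr0; apply: lerD; last first.
        by apply: sumr_ge0 => v _; apply: sqr_ge0.
      rewrite le_eqVlt; apply/orP; left; apply/eqP; apply: eq_bigl => v.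
      by case vZ : (v \in Z); rewrite ?andbF // (subsetP sZ v vZ).
    by rewrite ler_wpM2r // mulr_ge0 ?sqr_ge0.
  by rewrite le_eqVlt; apply/orP; left; apply/eqP; ring.
have P0 : 0 < 2%:R * t * n by rewrite mulr_gt0 // mulr_gt0.
by move: le1; rewrite (ler_pM2l P0).
Qed.

(** * Independent sets of prescribed size in every cluster *)

Lemma subset_of_card (A : {set T}) m : (m <= #|A|)%N -> exists2 B : {set T}, B \subset A & #|B| = m.
Proof.
move=> mA; exists [set x in take m (enum A)].
  by apply/subsetP => x; rewrite inE => /mem_take; rewrite mem_enum.
by rewrite cardsE (card_uniqP _) ?take_uniq ?enum_uniq // size_takel // -cardE.
Qed.

Lemma card_setD_ge (A X : {set T}) : c A - c (A :&: X) <= c (A :\: X).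
Proof. by rewrite lerBlDr -natrD ler_nat addnC cardsID. Qed.

Lemma card_union_le (X Y : {set T}) : c (X :|: Y) <= c X + c Y.
Proof. by rewrite -natrD ler_nat leq_card_setU. Qed.

Lemma card_le_sub (X Y : {set T}) : X \subset Y -> c X <= c Y.
Proof. by move=> sXY; rewrite ler_nat subset_leq_card. Qed.

Lemma neighbourhood_le (X : {set T}) : (#|\bigcup_(x in X) nb H x| <= #|X| * D)%N.
Proof.
apply: leq_trans (card_bigcup_le _ _) _; rewrite -sum_nat_const.
by apply: leq_sum => x _; apply: H_deg hs x.
Qed.

(** Greedy choice, one cluster at a time, avoiding the at most [r * b * D] neighbours of earlier
    choices. Inside a cluster [H] has no edges. *)
Lemma exists_buffer b : (b + r * b * D <= N)%N ->
  exists B : {set T}, (forall x y, x \in B -> y \in B -> ~~ H x y) /\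
    forall i, #|B :&: part i| = b.
Proof.
move=> bN.
suff [B [indB sizeB _]] : exists B : {set T}, [/\ forall x y, x \in B -> y \in B -> ~~ H x y,
    forall i : 'I_r, (i < r)%N -> #|B :&: part i| = b & (#|B| <= r * b)%N].
  by exists B; split=> // i; apply: sizeB.
have {bN} bN k : (k <= r)%N -> (b + k * b * D <= N)%N.
  by move=> kr; apply: leq_trans bN; rewrite leq_add2l !leq_mul.
suff main k : (k <= r)%N -> exists B : {set T}, [/\ forall x y, x \in B -> y \in B -> ~~ H x y,
    forall i : 'I_r, (i < k)%N -> #|B :&: part i| = b,
    forall i : 'I_r, (k <= i)%N -> B :&: part i = set0 & (#|B| <= k * b)%N].
  by have [B [h1 h2 _ h3]] := main r (leqnn r); exists B.
elim: k => [_|k IH kr].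
  by exists set0; split=> [x y|//|i _|]; rewrite ?inE ?set0I ?cards0.
have [B [indB sizeB disB cB]] := IH (ltnW kr).
pose j := Ordinal kr; pose NB := \bigcup_(x in B) nb H x.
have [|X sX cX] := @subset_of_card (part j :\: NB) b.
  have le1 : (#|NB| <= k * b * D)%N.
    by apply: leq_trans (neighbourhood_le B) _; rewrite leq_mul.
  have := cardsID NB (part j); rewrite (card_part hs).
  have := subset_leq_card (subsetIr (part j) NB); have := bN _ (ltnW kr); lia.
have sXj : X \subset part j by apply: subset_trans sX (subsetDl _ _).
have nXB x y : x \in X -> y \in B -> ~~ H y x.
  move=> xX yB; have := subsetP sX x xX; rewrite inE => /andP[+ _]; apply: contra => Hyx.
  by apply/bigcupP; exists y; rewrite ?inE.
exists (B :|: X); split.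
- move=> x y; rewrite !inE => /orP[] xB /orP[] yB.
  + exact: indB.
  + exact: nXB.
  + by rewrite (H_sym hs); apply: nXB.
  + apply/negP => /(H_cl hs); have := subsetP sXj x xB; have := subsetP sXj y yB.
    by rewrite !inE => /eqP-> /eqP->; rewrite eqxx.
- move=> i; rewrite ltnS leq_eqVlt => /orP[/eqP ik|ik].
    have -> : i = j by exact/val_inj.
    by rewrite setIUl disB // set0U (setIidPl sXj).
  rewrite setIUl (_ : X :&: part i = set0) ?setU0 ?sizeB //.
  apply/setP => x; rewrite !inE; apply/negbTE; rewrite negb_and.
  have [xX /=|//] := boolP (x \in X); have := subsetP sXj x xX; rewrite inE => /eqP->.
  by rewrite -val_eqE /=; lia.
- move=> i ki; rewrite setIUl disB ?set0U; last exact: ltnW.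
  apply/setP => x; rewrite !inE; apply/negbTE; rewrite negb_and.
  have [xX /=|//] := boolP (x \in X); have := subsetP sXj x xX; rewrite inE => /eqP->.
  by rewrite -val_eqE /=; lia.
- by apply: leq_trans (leq_card_setU _ _) _; rewrite cX mulSn addnC leq_add2l.
Qed.

(** The least natural number above [t] is less than [t + 1 <= 2 * t]. It exists because of [t <= n],
    as [K] need not be archimedean. *)
Lemma exists_nat_near (t : K) : 1 <= t -> t <= n ->
  exists b : nat, t <= b%:R /\ b%:R <= 2%:R * t.
Proof.
move=> t1 tn; have ex : exists b, t <= b%:R by exists N.
case: (ex_minnP ex) => b tb minb; exists b; split=> //.
case: b tb minb => [|b] tb minb; first by lra.
have : ~~ (t <= b%:R) by apply/negP => /minb; rewrite ltnn.
by rewrite -ltNge -addn1 natrD; lra.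
Qed.

(** * Extending a partial embedding *)

Definition ext (s s' : state) : Prop :=
  [/\ dom s \subset dom s', {in dom s, phi s' =1 phi s}, {in dom s, cand s' =1 cand s} &
      forall y, nb H y \subset dom s -> cand s' y = cand s y].

Lemma ext_trans s2 s1 s3 : ext s1 s2 -> ext s2 s3 -> ext s1 s3.
Proof.
move=> [a1 b1 c1 d1] [a2 b2 c2 d2]; split.
- exact: subset_trans a1 a2.
- by move=> x x1; rewrite b2 ?b1 // (subsetP a1).
- by move=> x x1; rewrite c2 ?c1 // (subsetP a1).
- by move=> y y1; rewrite d2 ?d1 //; apply: subset_trans y1 a1.
Qed.

Lemma ext_upd s x v : x \notin dom s -> ext s (upd s x v).
Proof.
move=> xnd; split=> /=.
- exact: subsetUr.
- by move=> y yd /=; case: eqP => // eyx; rewrite -eyx yd in xnd.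
- by move=> y yd /=; rewrite !inE yd.
- move=> y ys; rewrite !inE; case: ifP => // /andP[_ Hxy]; have := subsetP ys x.
  by rewrite inE (H_sym hs) => /(_ Hxy); rewrite (negbTE xnd).
Qed.

Lemma imset_ext s s' : ext s s' -> phi s @: dom s \subset phi s' @: dom s'.
Proof.
move=> [sd ep _ _]; apply/subsetP => _ /imsetP[x xd ->].
by rewrite -ep //; apply: imset_f; apply: (subsetP sd).
Qed.

(** Induction on the number of vertices of [W] left; [P] carries whatever the phase at hand must
    preserve. *)
Lemma iter_embed (P : state -> Prop) (W : {set T}) :
    (forall s x, P s -> x \in W -> x \notin dom s -> exists v, P (upd s x v)) ->
  forall s, P s -> exists s', [/\ P s', ext s s' & dom s' = dom s :|: W].
Proof.
move=> IH s; have [k] := ubnP #|W :\: dom s|; elim: k s => // k IHk s lek Ps.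
have [sW|/subsetPn[x xW xd]] := boolP (W \subset dom s).
  by exists s; split=> //; apply/esym/setUidPl.
have [v Pv] := IH _ _ Ps xW xd.
have [|s' [Ps' es' ds']] := IHk (upd s x v) _ Pv.
  rewrite /= setUC -setDDl; move: lek; rewrite (cardsD1 x) inE xd xW /= => lek.
  by rewrite ltnS in lek.
exists s'; split=> //; first exact: ext_trans (ext_upd v xd) es'.
by rewrite ds' /= [x |: _]setUC -setUA; congr (_ :|: _); apply/setUidPr; rewrite sub1set.
Qed.

Definition empty_state : state := State set0 id (fun y => part (cl y)) (fun=> 1) (fun=> 0%N).

Lemma inv_start (U : T -> {set T}) : (forall y, U y \subset part (cl y)) -> inv U empty_state.
Proof.
move=> sU; split=> /=; try by move=> // x; rewrite ?inE // => y; rewrite ?inE.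
- by move=> y; rewrite lexx.
- by move=> y; rewrite mul0r subr0 mul1r (card_part hs).
- by move=> y _; rewrite mul0r subr0 mul1r (setIidPr (sU y)).
- rewrite cards0 mul0r /total_defect big1 // => y _; rewrite big1 // => y'; rewrite inE => /eqP e.
  by rewrite /defect /= e setIid (card_part hs) !mul1r subrr normr0.
Qed.

(** Only [inv_res] mentions the reserve, so the reserve may be exchanged in the middle of the
    embedding. *)
Lemma inv_reserve U U' s : inv U s ->
  (forall y, y \notin dom s ->
     dens s y * c (U' y) - (emb s y)%:R * (eps * n) <= c (cand s y :&: U' y)) -> inv U' s.
Proof. by case=> *; split. Qed.

(** * The scale of thresholds [a ^ k * n] *)

Definition apn k : K := a ^+ k * n.

Lemma apn_gt0 k : 0 < apn k.
Proof. by rewrite mulr_gt0 ?apow_gt0 ?n_gt0. Qed.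

Lemma apn_scale j k m : (k + j <= m)%N -> (2 ^ j)%:R * apn m <= apn k.
Proof. by move=> km; rewrite mulrA ler_wpM2r ?ler0n ?apow_scale. Qed.

Lemma apnS k : a * apn k = apn k.+1.
Proof. by rewrite mulrA -exprS. Qed.

Lemma r_apn k : r%:R * apn k.+1 <= apn k.
Proof. by rewrite -apnS mulrA ler_piMl ?ra_le1 // ltW ?apn_gt0. Qed.

Lemma D_apn k : 2%:R * (D%:R * apn k.+1) <= apn k.
Proof.
rewrite -apnS 2!mulrA -[leRHS]mul1r ler_wpM2r //; first exact: ltW (apn_gt0 k).
by have := Da_le; rewrite -mulrA; lra.
Qed.

Lemma rD_apn k : r%:R * D%:R * apn k.+1 <= apn k.
Proof. by rewrite -apnS mulrA ler_piMl ?(rDa hs) // ltW ?apn_gt0. Qed.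

Lemma a25_n2 : a ^+ 25 * n ^+ 2 = apn 16 * apn 9.
Proof. by rewrite /apn [RHS]mulrACA -exprD -expr2. Qed.

Lemma D_small : D%:R <= apn 119.
Proof.
apply: (@le_trans _ _ (D%:R * eps * n)); first by rewrite -mulrA ler_peMr ?(eps_n hs).
by rewrite ler_wpM2r ?ler0n ?Deps.
Qed.

Lemma card_parts (X : {set T}) (t : K) : (forall i, c (X :&: part i) <= t) -> c X <= r%:R * t.
Proof.
move=> le_t; have eX : X = \bigcup_(i in 'I_r) (X :&: part i).
  apply/setP => v; apply/idP/bigcupP => [vX|[i _]]; last by rewrite inE => /andP[].
  by exists (cl v); rewrite // !inE vX eqxx.
apply: (@le_trans _ _ (\sum_(i in 'I_r) c (X :&: part i))).
  by rewrite -natr_sum ler_nat {1}eX card_bigcup_le.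
apply: (@le_trans _ _ (\sum_(i in 'I_r) t)); first exact: ler_sum.
by rewrite sumr_const card_ord mulr_natl.
Qed.

(** * Embedding the neighbours of the buffer and covering chosen places *)

Section Buffer.
Variables (B R0 : {set T}) (b u : nat).
Hypothesis B_indep : forall x y, x \in B -> y \in B -> ~~ H x y.
Hypothesis B_size : forall i, #|B :&: part i| = b.
Hypothesis R0_size : forall i, #|R0 :&: part i| = u.
Hypothesis b_lo : apn 8 <= b%:R.
Hypothesis b_hi : b%:R <= 2%:R * apn 8.
Hypothesis u_lo : apn 10 <= u%:R.
Hypothesis u_hi : u%:R <= 2%:R * apn 10.

Let NB := \bigcup_(x in B) nb H x.
Let res y := R0 :&: part (cl y).

Lemma NB_le : c NB <= 2%:R * apn 7.
Proof.
apply: (@le_trans _ _ (c B * D%:R)); first by rewrite -natrM ler_nat neighbourhood_le.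
have cB : c B <= r%:R * b%:R by apply: card_parts => i; rewrite B_size.
apply: (le_trans (ler_wpM2r (ler0n K D) cB)).
have := rD_apn 7; have := ler_wpM2l (mulr_ge0 (ler0n K r) (ler0n K D)) b_hi.
set x := apn 8; set y := apn 7; move: (r%:R) (D%:R) (b%:R : K) => p q s; lra.
Qed.

Lemma cand_large U s y : inv U s -> apn 1 - apn 119 <= c (cand s y).
Proof.
move=> Is; apply: le_trans (inv_cand Is y); apply: lerB; last exact: emb_le Is.
by rewrite /apn expr1 ler_wpM2r ?ler0n ?(dens_ge _ Is).
Qed.

Lemma card_reserve (X : {set T}) i : X \subset part i -> c (X :&: R0) <= u%:R.
Proof. by move=> sX; rewrite -(R0_size i) ler_nat subset_leq_card // setIC setIS. Qed.

(** Candidate sets have size about [a * n] or more, while the reserve and all images used here take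
    up only about [a ^ 7 * n] places. *)
Lemma phase1 : exists s, [/\ inv res s, dom s = NB & forall x, x \in dom s -> phi s x \notin R0].
Proof.
pose P s := [/\ inv res s, dom s \subset NB & forall x, x \in dom s -> phi s x \notin R0].
have stepP s x : P s -> x \in NB -> x \notin dom s -> exists v, P (upd s x v).
  move=> [Is sd av] xNB xd.
  have [|||v vA Iv] := @embed_step _ _ _ (cand s x :\: (R0 :|: phi s @: dom s)) Is xd.
  - exact: subsetDl.
  - rewrite disjoint_sym disjoint_subset; apply/subsetP => v vd.
    by rewrite !inE vd orbT.
  - apply: lt_le_trans (card_setD_ge _ _).
    have h1 : c (cand s x :&: (R0 :|: phi s @: dom s)) <= u%:R + 2%:R * apn 7.
      rewrite setIUr; apply: (le_trans (card_union_le _ _)); apply: lerD.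
        exact: card_reserve (inv_part Is x).
      apply: le_trans NB_le; apply: (@le_trans _ _ (c (phi s @: dom s))).
        by apply: card_le_sub; exact: subsetIr.
      rewrite ler_nat; apply: leq_trans (leq_imset_card _ _) _.
      exact: subset_leq_card.
    have := cand_large x Is; rewrite -/(apn 50).
    have := apn_gt0 1.
    have h2 : 64%:R * apn 7 <= apn 1 := @apn_scale 6 1 7 isT.
    have h3 : 64%:R * apn 10 <= apn 1 := @apn_scale 6 1 10 isT.
    have h4 : 64%:R * apn 119 <= apn 1 := @apn_scale 6 1 119 isT.
    have h5 : 64%:R * apn 50 <= apn 1 := @apn_scale 6 1 50 isT.
    move: h1 h2 h3 h4 h5 u_hi.
    set X1 := c _; set X2 := c _; set X3 := apn 1; set X4 := apn 7; set X5 := apn 10.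
    set X6 := apn 119; set X7 := apn 50; lra.
  - exists v; split=> //=; first by rewrite subUset sub1set xNB sd.
    move=> z; rewrite !inE; case: eqP => [_ _|_ /=]; last exact: av.
    by move: vA; rewrite !inE negb_or => /andP[/andP[]].
have [|s [[Is sd av] _ ds]] := iter_embed stepP (s := empty_state).
  split=> /=; [apply: inv_start => y; exact: subsetIr|exact: sub0set|by move=> x; rewrite inE].
by exists s; split=> //; rewrite ds /= set0U.
Qed.

(* A vertex x at distance at least 3 from [dom s] is sent to v, after its
   neighbours have been embedded into N(v), which serves as their reserve. *)
Lemma cover_one s v : inv res s -> NB \subset dom s -> [disjoint dom s & B] ->
    c (dom s) <= 4%:R * apn 7 -> v \notin phi s @: dom s ->
  exists s', [/\ inv res s', ext s s', [disjoint dom s' & B] /\ v \in phi s' @: dom s',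
    (#|dom s'| <= #|dom s| + D.+1)%N &
    forall y, y \in dom s' -> y \notin dom s -> phi s' y = v \/ phi s' y \notin R0].
Proof.
move=> Is sNB disB small vfree; set j := cl v.
pose N1 := \bigcup_(z in dom s) nb H z; pose N2 := \bigcup_(z in N1) nb H z.
(* [X] contains all vertices within distance 2 of the domain. Each passage to neighbours multiplies
   by at most [D], which costs one power of [a], so [X] does not fill the cluster of v. *)
pose X := dom s :|: (B :&: part j) :|: (N1 :|: N2).
have [x xj xX] : exists2 x, x \in part j & x \notin X.
  apply/subsetPn/negP => /card_le_sub; apply/negP; rewrite (card_part hs) -ltNge.
  have cN1 : c N1 <= c (dom s) * D%:R by rewrite -natrM ler_nat neighbourhood_le.
  have cN2 : c N2 <= c N1 * D%:R by rewrite -natrM ler_nat neighbourhood_le.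
  have d1 : c (dom s) * D%:R <= 2%:R * apn 6.
    have := ler_wpM2r (ler0n K D) small; have := D_apn 6.
    by move: (apn 7) (apn 6) => y z; rewrite mulrC; lra.
  have d2 : c N1 * D%:R <= apn 5.
    have := ler_wpM2r (ler0n K D) (le_trans cN1 d1); have := D_apn 5.
    by move: (apn 5) (apn 6) => y z; rewrite mulrC; lra.
  have cX : c X <= c (dom s) + b%:R + (c N1 + c N2).
    apply: (le_trans (card_union_le _ _)); apply: lerD; last exact: card_union_le.
    by rewrite -[in X in _ <= X](B_size j); exact: card_union_le.
  apply: (le_lt_trans cX).
  have h0 : n = apn 0 by rewrite /apn expr0 mul1r.
  have h2 : 32%:R * apn 7 <= apn 0 := @apn_scale 5 0 7 isT.
  have h3 : 32%:R * apn 6 <= apn 0 := @apn_scale 5 0 6 isT.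
  have h4 : 32%:R * apn 5 <= apn 0 := @apn_scale 5 0 5 isT.
  have h5 : 32%:R * apn 8 <= apn 0 := @apn_scale 5 0 8 isT.
  rewrite h0; have := apn_gt0 0; move: b_hi cN1 cN2 d1 d2 small h2 h3 h4 h5.
  move: (apn 0) (apn 5) (apn 6) (apn 7) (apn 8) => y0 y1 y2 y3 y4.
  move: (b%:R : K) (c N1) (c N2) (c (dom s)) => z1 z2 z3 z4.
  move: (_ * D%:R) (_ * D%:R) => w1 w2; lra.
move: xj xX; rewrite !in_setU [_ \in B :&: _]inE => xj; rewrite xj andbT !negb_or.
move=> /andP[/andP[xd xB] /andP[xN1 xN2]]; move: xj; rewrite inE => /eqP xj.
have fresh1 y : H x y -> y \notin dom s.
  move=> Hxy; apply: contra xN1 => yd; apply/bigcupP; exists y; rewrite // inE.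
  by rewrite (H_sym hs).
have fresh2 y z : H x y -> H y z -> z \notin dom s.
  move=> Hxy Hyz; apply: contra xN2 => zd; apply/bigcupP; exists y; last by rewrite inE (H_sym hs).
  by apply/bigcupP; exists z; rewrite // inE (H_sym hs).
(* With [R0] and the present images left out, only other neighbours of x, fewer than [D.+1], can
   compete for these places. *)
pose U' y := if H x y then (part (cl y) :&: nb G v) :\: (R0 :|: phi s @: dom s) else res y.
have IU : inv U' s.
  apply: (inv_reserve Is) => y yd; rewrite /U'; case: ifPn => Hxy; last by exact: (inv_res Is yd).
  (* As x is far from the domain, no neighbour of y is embedded: y still has its whole cluster as
     candidates, and so all of its new reserve. *)
  have [|-> ->] := inv_fresh Is (y := y).
    apply/setP => z; rewrite !inE; apply/negbTE; rewrite negb_and.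
    by case Hyz : (H y z) => //=; apply: fresh2 Hyz.
  set Z := _ :\: _; have sZ : Z \subset part (cl y).
    by apply: subset_trans (subsetDl _ _) (subsetIl _ _).
  by rewrite (setIidPr sZ) mul1r lerBlDr lerDl mulr_ge0 ?ler0n ?epsn_ge0.
have UL y : H x y -> apn 2 <= c (U' y).
  move=> Hxy; rewrite /U' Hxy; apply: le_trans (card_setD_ge _ _).
  have Rvy : R (cl v) (cl y) by rewrite -/j -xj; apply: H_R hs _ _ Hxy.
  have := G_deg hs Rvy; rewrite -[a in a * n]expr1 -/(apn 1).
  have h1 : c (part (cl y) :&: nb G v :&: (R0 :|: phi s @: dom s)) <= u%:R + 4%:R * apn 7.
    rewrite setIUr; apply: (le_trans (card_union_le _ _)); apply: lerD.
      by apply: (@card_reserve _ (cl y)); exact: subsetIl.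
    apply: le_trans small; apply: (@le_trans _ _ (c (phi s @: dom s))).
      by apply: card_le_sub; exact: subsetIr.
    by rewrite ler_nat; exact: leq_imset_card.
  have h2 : 64%:R * apn 7 <= apn 1 := @apn_scale 6 1 7 isT.
  have h3 : 64%:R * apn 10 <= apn 1 := @apn_scale 6 1 10 isT.
  have h4 : 2%:R * apn 2 <= apn 1 := @apn_scale 1 1 2 isT.
  have := apn_gt0 1; move: h1 h2 h3 h4 u_hi.
  move: (apn 1) (apn 2) (apn 7) (apn 10) (u%:R : K) (c _) (c _) => *; lra.
pose P t := [/\ inv U' t, ext s t, dom t \subset dom s :|: nb H x &
  forall y, y \in dom t -> y \notin dom s -> phi t y \in U' y].
have stepP t y : P t -> y \in nb H x -> y \notin dom t -> exists w, P (upd t y w).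
  move=> [It est sdt ph]; rewrite inE => Hxy yd.
  have [|||w wA Iw] := @embed_step _ _ _ ((cand t y :&: U' y) :\: phi t @: dom t) It yd.
  - by apply: subset_trans (subsetDl _ _) (subsetIl _ _).
  - by rewrite disjoint_sym disjoint_subset; apply/subsetP => w wd; rewrite !inE wd.
  - apply: lt_le_trans (card_setD_ge _ _).
    have h1 : c (cand t y :&: U' y :&: phi t @: dom t) <= D%:R.
      rewrite ler_nat; apply: leq_trans (H_deg hs x).
      apply: (@leq_trans #|phi t @: nb H x|); last exact: leq_imset_card.
      apply/subset_leq_card/subsetP => w; rewrite !inE -andbA => /and3P[_ wU /imsetP[z zd ez]].
      have := subsetP sdt z zd; rewrite inE => /orP[zs|zx]; last first.
        by apply/imsetP; exists z.
      move: wU; rewrite /U' Hxy !inE negb_or -andbA => /and3P[_ /negP[]].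
      by case: est => _ ep _ _; rewrite ez ep // imset_f.
    have h2 := inv_res It yd.
    have h3 : a * apn 2 <= dens t y * c (U' y).
      by rewrite ler_pM ?(ltW (a_gt0 hs)) ?(ltW (apn_gt0 2)) ?(dens_ge _ It) ?UL.
    have h4 := emb_le y It; rewrite -/(apn 119) in h4; rewrite apnS in h3; rewrite -/(apn 50).
    have h5 : 8%:R * apn 119 <= apn 3 := @apn_scale 3 3 119 isT.
    have h6 : 8%:R * apn 50 <= apn 3 := @apn_scale 3 3 50 isT.
    have := D_small; have := apn_gt0 3; move: h1 h2 h3 h4 h5 h6.
    move: (apn 3) (apn 119) (apn 50) ((emb t y)%:R * (eps * n)) (dens t y * c (U' y)) (D%:R : K) (c _) (c _) => *; lra.
  - exists w; split=> //.
    + by apply: ext_trans est (ext_upd w yd).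
    + by rewrite /= subUset sub1set inE [y \in nb H x]inE Hxy orbT.
    + move=> z /=; rewrite !inE; case: eqP => [-> _ _|_ /= zd]; last exact: ph.
      by move: wA; rewrite !inE => /and3P[].
have [|t [[It est sdt ph] _ dt]] := iter_embed stepP (s := s).
  by split=> //; [exact: subsetUl|move=> y ->].
have xt : x \notin dom t by rewrite dt !inE negb_or xd H_irr.
have td0 : todo t x = set0 by rewrite /todo dt setDUr setDv setI0.
have vfree_t z : z \in dom t -> phi t z != v.
  move=> zd; have [zs|zs] := boolP (z \in dom s).
    case: est => _ ep _ _; rewrite ep //; apply: contraNneq vfree => <-; exact: imset_f.
  have Hxz : H x z by have := subsetP sdt z zd; rewrite !inE (negbTE zs).
  have := ph z zd zs; rewrite /U' Hxz !inE => /and3P[_ _ Gv].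
  by apply: contraTneq Gv => ->; apply/negP => /(G_cl hs); rewrite eqxx.
have It' : inv U' (upd t x v).
  apply: inv_upd => //; first by split=> [y|y|]; rewrite td0 ?inE // big_set0 !mulr_ge0 ?exprn_ge0 ?ler0n ?(ltW (a_gt0 hs)).
  move=> y yd; rewrite (H_sym hs) => Hxy; have := ph y yd (fresh1 y Hxy).
  by rewrite /U' Hxy !inE (G_sym hs) => /and3P[].
exists (upd t x v); split.
(* All neighbours of x are embedded by now, so [U'] and [res] agree outside the domain and the old
   reserve can be restored. *)
- apply: (inv_reserve It') => y yd; have := inv_res It' yd; rewrite /U'; case: ifP => // Hxy.
  by move: yd; rewrite /= dt !inE Hxy !orbT.
- by apply: ext_trans est (ext_upd v xt).
- split; last by apply/imsetP; exists x; rewrite /= ?eqxx // !inE eqxx.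
  rewrite disjoint_subset; apply/subsetP => y; rewrite /= dt !inE.
  case/or3P => [/eqP->//|ys|Hxy].
    by move: disB; rewrite disjoint_subset => /subsetP/(_ y ys).
  apply: contra xd => yB; apply: (subsetP sNB); apply/bigcupP; exists y => //.
  by rewrite inE (H_sym hs).
- rewrite /= dt cardsU1 inE negb_or; apply: leq_trans (leq_add (leq_b1 _) (leq_card_setU _ _)) _.
  by rewrite addnCA leq_add2l add1n ltnS (H_deg hs).
- move=> y; rewrite /= !inE; case: eqP => [_ _ _|_ /= yd ys]; first by left.
  right; have := ph y yd ys; have : H x y by have := subsetP sdt y yd; rewrite !inE (negbTE ys).
  by rewrite /U' => ->; rewrite !inE negb_or => /andP[/andP[]].
Qed.

(** Each place costs at most [D.+1] embedded vertices from the budget [4 * a ^ 7 * n] that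
    [cover_one] tolerates; a place already occupied costs nothing. *)
Lemma cover_all (l : seq T) s : inv res s -> NB \subset dom s -> [disjoint dom s & B] ->
    c (dom s) + D.+1%:R * (size l)%:R <= 4%:R * apn 7 ->
  exists s', [/\ inv res s', ext s s', [disjoint dom s' & B], {subset l <= phi s' @: dom s'} &
    forall y, y \in dom s' -> y \notin dom s -> phi s' y \in l \/ phi s' y \notin R0].
Proof.
elim: l s => [|v l IH] s Is sNB disB small.
  by exists s; split=> // y ->.
have D0 : 0 <= D.+1%:R :> K by exact: ler0n.
move: small; rewrite /= -[(size l).+1]add1n natrD mulrDr mulr1 => small.
have l0 := mulr_ge0 D0 (ler0n K (size l)).
have [vi|vi] := boolP (v \in phi s @: dom s).
  have [|s' [Is' es' dis' cov av]] := IH s Is sNB disB; first by lra.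
  exists s'; split=> // [w|y yd ys].
    by rewrite inE => /predU1P[->|/cov //]; apply: (subsetP (imset_ext es')).
  by case: (av y yd ys) => [yl|]; [left; rewrite inE yl orbT|right].
have [|s1 [Is1 es1 [dis1 v1] c1 av1]] := cover_one Is sNB disB _ vi; first by lra.
have ss1 : dom s \subset dom s1 by case: es1.
have [||s' [Is' es' dis' cov av]] := IH s1 Is1 _ dis1; first exact: subset_trans sNB ss1.
  have : c (dom s1) <= c (dom s) + D.+1%:R by rewrite -natrD ler_nat.
  lra.
exists s'; split=> // [|w|y yd ys]; first exact: ext_trans es1 es'.
  by rewrite inE => /predU1P[->|/cov //]; apply: (subsetP (imset_ext es')).
have [y1|y1] := boolP (y \in dom s1).
  case: es' => _ ep _ _; rewrite ep //.
  by case: (av1 y y1 ys) => [->|]; [left; rewrite inE eqxx|right].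
by case: (av y yd y1) => [yl|]; [left; rewrite inE yl orbT|right].
Qed.

(** * Exceptional places, stuck vertices and the use of the reserve *)

Definition bdeg (s : state) v : K := c [set y in B :&: part (cl v) | v \in cand s y].

(** Densities are at least [a], so [a * b] is a lower bound for the expected value of [bdeg]; the
    threshold is half of it. *)
Definition exceptional (s : state) := [set v | 2%:R * bdeg s v < a * b%:R].

(** Between the buffer of the cluster and its exceptional places at least half of the expected
    [a * b] candidate pairs per place are missing; [discrepancy] allows [a ^ 25 * n ^ 2] in all, and
    [a * b] is at least [a ^ 9 * n]. *)
Lemma exceptional_le U s j : inv U s -> c (exceptional s :&: part j) <= 2%:R * apn 16.
Proof.
move=> Is; set Z := exceptional s :&: part j.
have n0 := n_gt0; have a0 := a_gt0 hs.
have disc := discrepancy Is (subsetIr B (part j)) (subsetIr (exceptional s) (part j)).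
rewrite -/Z in disc.
have h1 : \sum_(y in B :&: part j) c (cand s y :&: Z) = \sum_(v in Z) bdeg s v.
  have e1 y : c (cand s y :&: Z) = \sum_(v in Z) (v \in cand s y)%:R.
    rewrite -sum1_card natr_sum big_mkcond [RHS]big_mkcond /=; apply: eq_bigr => v _.
    by rewrite inE andbC; case: (v \in Z) => //=; case: (v \in _).
  under eq_bigr do rewrite e1.
  rewrite exchange_big; apply: eq_bigr => v; rewrite !inE => /andP[_ /eqP clv].
  rewrite /bdeg clv -sum1_card natr_sum [RHS]big_mkcond [LHS]big_mkcond /=.
  apply: eq_bigr => y _; rewrite !inE.
  by case: (y \in B) => //=; case: (cl y == j) => //=; case: (v \in _).
have h2 : \sum_(v in Z) bdeg s v <= c Z * (a * b%:R / 2%:R).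
  rewrite -sum1_card natr_sum mulr_suml; apply: ler_sum => v; rewrite !inE => /andP[lt1 _].
  by rewrite mul1r ler_pdivlMr // mulrC ltW.
have h3 : b%:R * (a * c Z) <= \sum_(y in B :&: part j) dens s y * c Z.
  rewrite -(B_size j) -[in X in X <= _]sum1_card natr_sum mulr_suml; apply: ler_sum => y _.
  by rewrite mul1r ler_wpM2r ?ler0n // (dens_ge _ Is).
move: disc; rewrite sumrB h1 => disc.
have cZ0 : 0 <= c Z by exact: ler0n.
have h4 : c Z * (a * b%:R) <= 2%:R * (a ^+ 25 * n ^+ 2).
  rewrite (_ : c Z * (a * b%:R) = b%:R * (a * c Z) + b%:R * (a * c Z) - 2%:R * (c Z * (a * b%:R / 2%:R))); last first.
    by field.
  by move: (le_trans h3 (lexx _)) h2 disc; lra.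
have h5 : c Z * apn 9 <= c Z * (a * b%:R).
  by rewrite ler_wpM2l // -apnS ler_wpM2l // ltW.
rewrite -(ler_pM2r (apn_gt0 9)); by apply: le_trans (le_trans h5 h4) _; rewrite a25_n2 mulrA.
Qed.

(* As images are added and candidate sets frozen, an embedded vertex stays
   stuck: [stuck_le] at a later time bounds all earlier uses of the reserve. *)
Definition stuck (s : state) := [set y | c (cand s y :\: (R0 :|: phi s @: dom s)) < apn 11].

Lemma imset_part U s j : inv U s ->
  phi s @: dom s :&: part j = phi s @: (dom s :&: part j).
Proof.
move=> Is; apply/setP => v; apply/setIP/imsetP => [[/imsetP[x xd ->]]|[x]].
  by rewrite inE => /eqP cx; exists x; rewrite // !inE xd -(inv_cl Is xd) cx eqxx.
rewrite !inE => /andP[xd /eqP cx] ->; rewrite (inv_cl Is xd) cx eqxx; split=> //.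
exact: imset_f.
Qed.

(** A cluster has as many places as vertices, and its [b] buffer vertices are not embedded yet. *)
Lemma free_ge U s j : inv U s -> [disjoint dom s & B] ->
  b%:R <= c (part j :\: phi s @: dom s).
Proof.
move=> Is disB; apply: le_trans (card_setD_ge _ _); rewrite setIC (imset_part _ Is).
rewrite lerBrDr -natrD (card_part hs) ler_nat -(B_size j).
apply: (@leq_trans (#|B :&: part j| + #|dom s :&: part j|)).
  by rewrite leq_add2l leq_imset_card.
have dis : (B :&: part j) :&: (dom s :&: part j) = set0.
  by rewrite setIACA [B :&: _]setIC (disjoint_setI0 disB) set0I.
rewrite -(card_part hs j) -[(_ + _)%N]subn0 -(cards0 T) -dis -cardsU.
by rewrite subset_leq_card // subUset !subsetIr.
Qed.

(** The free places [Z] outside the reserve number at least [a ^ 8 * n / 2]. A stuck vertex should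
    have [a * #|Z|] candidates there but has fewer than [a ^ 11 * n]; this deficit contradicts
    [discrepancy] if there are many such vertices. *)
Lemma stuck_le U s j : inv U s -> [disjoint dom s & B] ->
  c (stuck s :&: part j) <= 4%:R * apn 16.
Proof.
move=> Is disB; set S := stuck s :&: part j; set Z := part j :\: (R0 :|: phi s @: dom s).
have a0 := a_gt0 hs; have n0 := n_gt0.
have sZ : Z \subset part j by exact: subsetDl.
have disc := discrepancy Is (subsetIr (stuck s) (part j)) sZ; rewrite -/S in disc.
have cZ : apn 8 <= 2%:R * c Z.
  have h1 := free_ge j Is disB.
  have h2 : c (part j :\: phi s @: dom s) - u%:R <= c Z.
    rewrite /Z setUC -setDDl; apply: le_trans (card_setD_ge _ _); rewrite lerD2l lerN2.
    by apply: (@card_reserve _ j); exact: subsetDl.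
  have h3 : 4%:R * apn 10 <= apn 8 := @apn_scale 2 8 10 isT.
  have := apn_gt0 8; move: b_lo u_hi h1 h2 h3.
  move: (c Z) (c _) (apn 8) (apn 10) (b%:R : K) (u%:R : K) => *; lra.
have h1 : c S * (a * c Z - apn 11) <= a ^+ 25 * n ^+ 2.
  apply: le_trans disc; rewrite -sum1_card natr_sum mulr_suml; apply: ler_sum => y.
  rewrite !inE mul1r => /andP[/ltW st /eqP cy]; apply: lerB.
    by rewrite ler_wpM2r ?ler0n // (dens_ge _ Is).
  by apply: le_trans st; apply: card_le_sub; rewrite /Z setIDA setSD // subsetIl.
have h2 : apn 9 <= 4%:R * (a * c Z - apn 11).
  have h3 : 4%:R * apn 11 <= apn 9 := @apn_scale 2 9 11 isT.
  have h4 : apn 9 <= 2%:R * (a * c Z) by rewrite -apnS [leRHS]mulrCA ler_wpM2l // ltW.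
  by have := apn_gt0 9; move: h3 h4; move: (a * c Z) (apn 9) (apn 11) => *; lra.
have h3 := ler_wpM2l (ler0n K #|S|) h2.
rewrite -(ler_pM2r (apn_gt0 9)); apply: le_trans h3 _; rewrite mulrCA -mulrA ler_wpM2l //.
apply: le_trans h1 _.
by rewrite a25_n2.
Qed.

(** Every use of the reserve is charged to a place of [E] or to a stuck vertex, and both are few. *)
Definition thrifty (E : {set T}) (s : state) : Prop :=
  forall x, x \in dom s -> phi s x \in R0 -> phi s x \in E \/ x \in stuck s.

(** By [inv_res] about [a * a ^ 10 * n] candidates lie in the reserve, and by thrift at most
    [6 * a ^ 16 * n] reserve places of the cluster are occupied. *)
Lemma reserve_left E s j : inv res s -> [disjoint dom s & B] -> thrifty E s ->
    c (E :&: part j) <= 2%:R * apn 16 ->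
  forall x, x \notin dom s -> cl x = j ->
    apn 12 <= c (cand s x :&: res x :\: phi s @: dom s).
Proof.
move=> Is disB th cE x xd cx; apply: le_trans (card_setD_ge _ _).
have h1 : c (cand s x :&: res x :&: phi s @: dom s) <= 6%:R * apn 16.
  apply: (@le_trans _ _ (c ((E :&: part j) :|: phi s @: (stuck s :&: part j)))).
    apply/card_le_sub/subsetP => v; rewrite !inE cx -!andbA => /and4P[_ vR cv /imsetP[z zd ez]].
    rewrite cv andbT; case: (th z zd); first by rewrite -ez.
      by rewrite -ez => ->.
    move=> zs; apply/orP; right; rewrite ez imset_f // !inE -(inv_cl Is zd) -ez cv andbT.
    by move: zs; rewrite inE.
  apply: (le_trans (card_union_le _ _)).
  have h1 := stuck_le j Is disB.
  have h2 : c (phi s @: (stuck s :&: part j)) <= c (stuck s :&: part j).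
    by rewrite ler_nat leq_imset_card.
  by move: cE h1 h2; set x1 := c _; set x2 := c _; set x3 := c _; lra.
have h2 := inv_res Is xd; have h3 := emb_le x Is; rewrite -/(apn 119) in h3.
have h4 : apn 11 <= dens s x * c (res x).
  rewrite -apnS; apply: ler_pM; rewrite ?(ltW (a_gt0 hs)) ?(ltW (apn_gt0 _)) ?(dens_ge _ Is) //.
  by rewrite R0_size.
have h5 : 32%:R * apn 16 <= apn 11 := @apn_scale 5 11 16 isT.
have h6 : 32%:R * apn 119 <= apn 11 := @apn_scale 5 11 119 isT.
have h7 : 2%:R * apn 12 <= apn 11 := @apn_scale 1 11 12 isT.
have := apn_gt0 11; move: h1 h2 h3 h4 h5 h6 h7.
move: (apn 11) (apn 12) (apn 16) (apn 119) ((emb s x)%:R * (eps * n)) (dens s x * c (res x)).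
move: (c _) (c _) => *; lra.
Qed.

Lemma stuck_upd s x v z : x \notin dom s -> z \notin todo s x ->
  z \in stuck s -> z \in stuck (upd s x v).
Proof.
move=> xd zt; rewrite !inE; apply: le_lt_trans; apply: card_le_sub.
have -> : cand (upd s x v) z = cand s z by rewrite /= (negbTE zt).
by rewrite setDS // setUS // (imset_ext (ext_upd v xd)).
Qed.

Lemma phase2 E s : inv res s -> [disjoint dom s & B] -> thrifty E s ->
    (forall j, c (E :&: part j) <= 2%:R * apn 16) ->
  exists s', [/\ inv res s', ext s s', dom s' = ~: B & thrifty E s'].
Proof.
move=> Is disB th cE.
pose P t := [/\ inv res t, [disjoint dom t & B] & thrifty E t].
have stepP t x : P t -> x \in ~: B -> x \notin dom t -> exists v, P (upd t x v).
  move=> [It dist tht]; rewrite inE => xB xd.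
  have disu v : [disjoint dom (upd t x v) & B].
    rewrite disjoint_subset; apply/subsetP => y; rewrite !inE => /predU1P[->//|yd].
    by move: dist; rewrite disjoint_subset => /subsetP/(_ y yd).
  have thr v : v \notin R0 \/ x \in stuck t -> thrifty E (upd t x v).
    move=> vx z; rewrite [dom _]/= [phi _]/= in_setU1; case: eqP => [-> _ vR|_ /= zd zR].
      right; apply: stuck_upd => //; last by case: vx; rewrite ?vR.
      by rewrite !inE H_irr andbF.
    by case: (tht z zd zR) => zt; [left|right; apply: stuck_upd; rewrite // !inE zd].
  have big (A : {set T}) k : A \subset cand t x -> [disjoint A & phi t @: dom t] ->
      (k <= 12)%N -> apn k <= c A -> exists2 v, v \in A & inv res (upd t x v).
    move=> sA dA k12 cA; apply: embed_step => //; apply: lt_le_trans cA; rewrite -/(apn 50).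
    have h : 2%:R * apn 50 <= apn k by apply: (@apn_scale 1); lia.
    by have := apn_gt0 50; move: h; move: (apn 50) (apn k) => *; lra.
  (* A stuck vertex goes into the reserve, where [reserve_left] finds room; any other has
     [a ^ 11 * n] free candidates outside. *)
  have [st|nst] := boolP (x \in stuck t).
    have [||||v vA Iv] := @big (cand t x :&: res x :\: phi t @: dom t) 12.
    + by apply: subset_trans (subsetDl _ _) (subsetIl _ _).
    + by rewrite disjoint_subset; apply/subsetP => w; rewrite !inE => /andP[].
    + by [].
    + exact: (reserve_left (j := cl x) It dist tht).
    by exists v; split=> //; apply: thr; right.
  have [||||v vA Iv] := @big (cand t x :\: (R0 :|: phi t @: dom t)) 11.
  + exact: subsetDl.
  + by rewrite disjoint_subset; apply/subsetP => w; rewrite !inE negb_or => /andP[/andP[]].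
  + by [].
  + by move: nst; rewrite inE -leNgt.
  exists v; split=> //; apply: thr; left.
  by move: vA; rewrite !inE negb_or => /andP[/andP[]].
have [|s' [[Is' dis' th'] es' ds']] := iter_embed stepP (s := s); first by split.
exists s'; split=> //; rewrite ds'; apply/setUidPr; rewrite -disjoints_subset //.
Qed.

(** * Hall's condition for the buffer and the complete embedding *)

Lemma buffer_matching U s1 s j : inv U s1 -> inv res s -> dom s = ~: B ->
    {in B, cand s =1 cand s1} -> thrifty (exceptional s1) s ->
    exceptional s1 \subset phi s @: dom s ->
  exists m : T -> option T, {in B :&: part j &, injective m} /\
    forall y, y \in B :&: part j ->
      exists2 v, v \in cand s y :\: phi s @: dom s & m y = Some v.
Proof.
move=> Is1 Is ds cB th cov; apply: hall_marriage => X sX.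
have disB : [disjoint dom s & B] by rewrite ds disjoints_subset.
set A := fun y => cand s y :\: phi s @: dom s; set W := \bigcup_(x in X) A x.
have XB y : y \in X -> y \in B /\ cl y = j.
  by move=> /(subsetP sX); rewrite !inE => /andP[yB /eqP].
have [->|[y0 y0X]] := set_0Vmem X; first by rewrite cards0.
rewrite -(ler_nat K) leNgt; apply/negP => ltWX.
have [y0B cy0] := XB y0 y0X.
(* A violating set is not small, since a single buffer vertex already has [a ^ 12 * n] free
   candidates in the reserve. *)
have cX : apn 12 < c X.
  apply: le_lt_trans ltWX; apply: (@le_trans _ _ (c (A y0))); last first.
    by apply: card_le_sub; apply: bigcup_sup y0X.
  have y0d : y0 \notin dom s by rewrite ds inE y0B.
  apply: le_trans (reserve_left Is disB th (exceptional_le j Is1) y0d cy0) _.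
  by apply: card_le_sub; rewrite setSD // subsetIl.
(* No vertex of [X] has a candidate among these free places, so [discrepancy] forces [Z] to be small
   because [X] is large. *)
pose Z := part j :\: (phi s @: dom s) :\: W.
have cZ : b%:R - c W <= c Z.
  apply: le_trans (card_setD_ge _ _); apply: lerB; first exact: free_ge Is disB.
  by apply: card_le_sub; exact: subsetIr.
have sZ : Z \subset part j by rewrite /Z !subDset; apply/subsetP => v; rewrite !inE => ->; rewrite !orbT.
have cXb : c X <= b%:R by rewrite -(B_size j) card_le_sub.
have disc := discrepancy Is (subset_trans sX (subsetIr _ _)) sZ.
have empty y : y \in X -> cand s y :&: Z = set0.
  move=> yX; apply/setP => v; rewrite !inE; apply/negbTE; apply/negP.
  move=> /and4P[vC nW nI _]; move/negP: nW; apply; apply/bigcupP; exists y => //.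
  by rewrite !inE nI.
have h1 : c X * (a * c Z) <= a ^+ 25 * n ^+ 2.
  apply: le_trans disc; rewrite -[in X in X * _]sum1_card natr_sum mulr_suml; apply: ler_sum => y yX.
  by rewrite empty // cards0 subr0 mul1r ler_wpM2r ?ler0n // (dens_ge _ Is).
have cZ12 : c Z <= apn 12.
  have h2 : apn 12 * (a * c Z) <= apn 12 * apn 13.
    apply: (@le_trans _ _ (c X * (a * c Z))).
      by rewrite ler_wpM2r ?(ltW cX) // mulr_ge0 ?ler0n // ltW // (a_gt0 hs).
    by apply: le_trans h1 _; rewrite /apn [leRHS]mulrACA -exprD -expr2.
  by move: h2; rewrite (ler_pM2l (apn_gt0 12)) -apnS (ler_pM2l (a_gt0 hs)).
have [v vZ] : exists v, v \in Z.
  apply/card_gt0P; rewrite -(ltr_nat K).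
  by clear ds cy0; move: cZ cXb ltWX; move: (c X) (c W) (c Z) => *; lra.
move: vZ; rewrite !inE => /and3P[vW vI /eqP cv].
(* Exceptional places are all occupied, so v is a candidate of at least [a * b / 2] buffer vertices,
   none of them in [X]. Yet [X] misses fewer than [a ^ 12 * n] of the [b] buffer vertices. *)
have vE : v \notin exceptional s1 by apply: contra vI; apply: (subsetP cov).
have le1 : bdeg s1 v <= b%:R - c X.
  rewrite lerBrDr -natrD ler_nat -(B_size j) cv.
  set Y := [set y in _ | _].
  have sY : Y \subset B :&: part j by apply/subsetP => y; rewrite inE => /andP[].
  have -> : (#|Y| + #|X| = #|Y :|: X|)%N.
    rewrite cardsU (_ : Y :&: X = set0) ?cards0 ?subn0 //.
    apply/setP => y; rewrite !inE; apply/negbTE; apply/negP => /andP[/andP[_ vy] yX].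
    move/negP: vW; apply; apply/bigcupP; exists y => //; rewrite inE vI.
    by rewrite cB //; case: (XB y yX).
  by rewrite subset_leq_card // subUset sY.
have h8 : apn 9 <= 2%:R * bdeg s1 v.
  apply: (@le_trans _ _ (a * b%:R)); first by rewrite -apnS ler_wpM2l // ltW // (a_gt0 hs).
  by move: vE; rewrite inE -leNgt.
have h9 : 8%:R * apn 12 <= apn 9 := @apn_scale 3 9 12 isT.
have := apn_gt0 9; move: le1 h8 h9 cZ12 cZ ltWX.
by clear ds cy0 cv; move: (bdeg _ _) (apn 9) (apn 12) (c X) (c W) (c Z) => *; lra.
Qed.

Lemma embedding_of_buffer :
  exists f : T -> T, injective f /\ forall x y, H x y -> G (f x) (f y).
Proof.
have [s1 [Is1 d1 av1]] := phase1.
have disNB : [disjoint dom s1 & B].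
  rewrite d1 disjoint_subset; apply/subsetP => y /bigcupP[x xB]; rewrite !inE => Hxy.
  by apply/negP => yB; have := B_indep xB yB; rewrite Hxy.
pose E := exceptional s1.
(* The factor [r] from summing over the clusters costs one power of [a]. *)
have cE : c E <= 2%:R * apn 15.
  apply: le_trans (card_parts (fun i => exceptional_le i Is1)) _.
  by rewrite mulrCA ler_wpM2l // r_apn.
have [||s2 [Is2 es2 dis2 cov2 av2]] := @cover_all (enum E) s1 Is1 _ disNB.
- by rewrite d1.
- rewrite d1 -cardE; have h1 := NB_le; have h2 := D_ge1.
  have h3 : D.+1%:R * c E <= 2%:R * D%:R * (2%:R * apn 15).
    by apply: ler_pM; rewrite ?ler0n // -natrM ler_nat; have := D_gt0 hs; lia.
  have h4 := D_apn 14.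
  have h5 : 2%:R * apn 14 <= apn 7 := @apn_scale 1 7 14 isT.
  have := apn_gt0 14; move: h1 h3 h4 h5.
  move: (c E) (apn 14) (apn 15) (apn 7) (c NB) => x1 x2 x3 x4 x5.
  move: (D.+1%:R * x1) (D%:R : K) => x6 x7; nra.
(* The first phase avoids the reserve, and the covering enters it at exceptional places only. *)
have th2 : thrifty E s2.
  move=> x xd xR; have [x1|x1] := boolP (x \in dom s1).
    by move: xR; case: es2 => _ ep _ _; rewrite ep // (negbTE (av1 x x1)).
  by case: (av2 x xd x1); [rewrite mem_enum; left|rewrite xR].
have [s [Is es ds th]] := phase2 Is2 dis2 th2 (fun j => exceptional_le j Is1).
(* All neighbours of the buffer belong to [dom s1], so its candidate sets are frozen from then
   on. *)
have cB : {in B, cand s =1 cand s1}.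
  move=> y yB; case: (ext_trans es2 es) => _ _ _; apply; rewrite d1.
  by apply/subsetP => x xy; apply/bigcupP; exists y.
have cov : E \subset phi s @: dom s.
  by apply: subset_trans (imset_ext es); apply/subsetP => v vE; apply: cov2; rewrite mem_enum.
have [m mP] := fin_all_exists (fun j => buffer_matching j Is1 Is ds cB th cov).
(* The default [x] never occurs, as the matching is defined on the whole buffer. *)
pose f x := if x \in B then odflt x (m (cl x) x) else phi s x.
have fB x : x \in B -> exists2 v, v \in cand s x :\: phi s @: dom s & m (cl x) x = Some v.
  by move=> xB; case: (mP (cl x)) => _; apply; rewrite !inE xB eqxx.
have dB x : (x \in dom s) = (x \notin B) by rewrite ds inE.
have clf x : cl (f x) = cl x.
  rewrite /f; case: ifPn => [xB|]; last by rewrite -dB; apply: (inv_cl Is).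
  have [v + ->] := fB x xB; rewrite inE => /andP[_ vC].
  by apply/eqP; have := subsetP (inv_part Is x) v vC; rewrite inE.
exists f; split=> [x y exy|x y Hxy].
  have cxy : cl x = cl y by rewrite -clf exy clf.
  move: exy; rewrite /f; case: ifPn => xB; case: ifPn => yB.
  - have [v _ ev] := fB x xB; have [w _ ew] := fB y yB; rewrite ev ew /= => evw.
    case: (mP (cl x)) => inj _; apply: inj; rewrite ?inE ?xB ?yB ?cxy ?eqxx //.
    by rewrite ew -cxy ev evw.
  - have [v + ->] := fB x xB; rewrite inE => /andP[/negP nv _] /= ev; case: nv.
    by rewrite ev imset_f // dB.
  - have [v + ->] := fB y yB; rewrite inE => /andP[/negP nv _] /= ev; case: nv.
    by rewrite -ev imset_f // dB.
  - by apply: (inv_inj Is); rewrite dB.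
rewrite /f; case: ifPn => xB; case: ifPn => yB.
- by have := B_indep xB yB; rewrite Hxy.
- have [v + ->] := fB x xB; rewrite inE => /andP[_ vC] /=; rewrite (G_sym hs).
  by apply: (inv_adj Is _ _ _ vC); rewrite ?dB ?yB ?xB // (H_sym hs).
- have [v + ->] := fB y yB; rewrite inE => /andP[_ vC] /=.
  by apply: (inv_adj Is _ _ Hxy vC); rewrite ?dB ?yB ?xB.
- by apply: (inv_hom Is); rewrite ?dB.
Qed.

End Buffer.

(** * Sizes of the buffer and the reserve *)

Lemma permutation_embedding : exists f : T -> T, injective f /\ forall x y, H x y -> G (f x) (f y).
Proof.
have n_eq : n = apn 0 by rewrite /apn expr0 mul1r.
have ap_ge1 k : (k <= 120)%N -> 1 <= apn k.
  move=> k120; apply: le_trans (eps_n hs) _; rewrite /apn ler_wpM2r ?ler0n //.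
  exact: le_trans (eps_le hs) (apow_le k120).
have ap_le k : apn k <= n by rewrite n_eq; have := @apn_scale 0 0 k isT; rewrite mul1r.
(* The buffer is so small that its neighbourhoods up to a few steps do not fill a cluster; the
   reserve, two powers of [a] smaller, is negligible beside the buffer. *)
have [b [b1 b2]] := exists_nat_near (ap_ge1 8 isT) (ap_le 8).
have [u [u1 u2]] := exists_nat_near (ap_ge1 10 isT) (ap_le 10).
have buf m : m%:R <= 2%:R * apn 8 -> (m + r * m * D <= N)%N.
  move=> mle; rewrite -(ler_nat K) natrD !natrM mulrAC.
  have := rD_apn 7; have := ler_wpM2l (mulr_ge0 (ler0n K r) (ler0n K D)) mle.
  have h1 : 8%:R * apn 7 <= apn 0 := @apn_scale 3 0 7 isT.
  have h2 : 8%:R * apn 8 <= apn 0 := @apn_scale 3 0 8 isT.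
  rewrite n_eq; have := apn_gt0 0; move: mle h1 h2.
  move: (r%:R * D%:R) (apn 0) (apn 7) (apn 8) (m%:R : K) => x y z w t; nra.
have [B [Bi Bs]] := exists_buffer (buf b b2).
have [|R0 [_ Rs]] := exists_buffer (b := u).
  by apply: buf; apply: le_trans u2 _; rewrite ler_wpM2l //; have := @apn_scale 0 8 10 isT; rewrite mul1r.
exact: (embedding_of_buffer Bi Bs Rs b1 b2 u1 u2).
Qed.

End Core.

(** * Regular pairs in terms of degrees *)

Section Density.
Variables (K : realType) (T : finType) (E : rel T).
Local Notation c A := (#|(A : {set T})|%:R : K).

Lemma edges_betweenE (X Y : {set T}) :
  (edges_between E X Y)%:R = \sum_(x in X) c (Y :&: nb E x) :> K.
Proof.
rewrite -natr_sum /edges_between; congr (_%:R).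
rewrite -sum1_card (eq_bigl (fun p => (p.1 \in X) && ((p.2 \in Y) && E p.1 p.2))); last first.
  by move=> p; rewrite !inE andbA.
rewrite -(pair_big_dep (fun x => x \in X) (fun x y => (y \in Y) && E x y) (fun _ _ => 1%N)) /=.
by apply: eq_bigr => x _; rewrite sum1_card; apply: eq_card => y; rewrite !inE.
Qed.

Lemma density_le1 (X Y : {set T}) : density K E X Y <= 1.
Proof.
rewrite /density; have [->|nz] := eqVneq (c X * c Y) 0; first by rewrite invr0 mulr0.
rewrite ler_pdivrMr; last by rewrite lt0r nz mulr_ge0.
rewrite mul1r edges_betweenE -[in leRHS]sum1_card natr_sum mulr_suml.
by apply: ler_sum => x _; rewrite mul1r ler_nat subset_leq_card // subsetIl.
Qed.

Variables (A B : {set T}) (N : nat) (eps : K).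
Hypotheses (cA : #|A| = N) (cB : #|B| = N) (eps0 : 0 < eps) (reg : regular_pair eps E A B).
Let d := density K E A B.

(** Too many low vertices would form with [X] a pair of density at most [d - eps]. Regularity
    applies to it: a degree is nonnegative, so a low one forces [eps * N < d * #|X| <= #|X|]. *)
Lemma few_low_degree (X : {set T}) : X \subset B ->
  c [set v in A | c (X :&: nb E v) < d * c X - eps * N%:R] <= eps * N%:R.
Proof.
move=> sX; set Y := [set v in A | _]; rewrite leNgt; apply/negP => ltY.
have sY : Y \subset A by apply/subsetP => v; rewrite inE => /andP[].
have eN : 0 <= eps * N%:R by rewrite mulr_ge0 ?ler0n // ltW.
have Y0 : 0 < c Y by apply: le_lt_trans ltY.
have [v vY] : exists v, v \in Y by apply/card_gt0P; rewrite -(ltr_nat K).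
have X0 : 0 < c X.
  move: vY; rewrite inE lt0r ler0n andbT => /andP[_]; apply: contraTneq => X0.
  by rewrite X0 mulr0 sub0r -leNgt (le_trans _ (ler0n _ _)) // oppr_le0.
have ltX : eps * N%:R < c X.
  move: vY; rewrite inE => /andP[_ lt1]; have := le_lt_trans (ler0n _ _) lt1.
  by rewrite subr_gt0 => /lt_le_trans; apply; rewrite ler_piMl ?density_le1 // ltW.
have := reg sY sX; rewrite cA cB => /(_ ltY ltX); rewrite ltr_norml -/d => /andP[+ _].
apply/negP; rewrite -leNgt lerBlDr /density ler_pdivrMr ?mulr_gt0 // edges_betweenE.
rewrite -[in leRHS]sum1_card natr_sum mulr_suml mulr_sumr; apply: ler_sum => w.
rewrite inE mul1r => /andP[_ /ltW le1]; apply: le_trans le1 _.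
rewrite mulrDl addrC lerD2r mulNr lerN2 ler_wpM2l ?(ltW eps0) //.
by rewrite -cB ler_nat subset_leq_card.
Qed.

(** Here the density would be at least [d + eps], and [X] is large because it contains more than
    [eps * N] neighbours of one vertex. *)
Lemma few_high_degree (X : {set T}) : X \subset B ->
  c [set v in A | d * c X + eps * N%:R < c (X :&: nb E v)] <= eps * N%:R.
Proof.
move=> sX; set Y := [set v in A | _]; rewrite leNgt; apply/negP => ltY.
have sY : Y \subset A by apply/subsetP => v; rewrite inE => /andP[].
have eN : 0 <= eps * N%:R by rewrite mulr_ge0 ?ler0n // ltW.
have Y0 : 0 < c Y by apply: le_lt_trans ltY.
have d0 : 0 <= d by rewrite /d /density divr_ge0 ?mulr_ge0 ?ler0n.
have [v vY] : exists v, v \in Y by apply/card_gt0P; rewrite -(ltr_nat K).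
have ltX : eps * N%:R < c X.
  move: vY; rewrite inE => /andP[_ lt1]; apply: (@lt_le_trans _ _ (c (X :&: nb E v))).
    by apply: le_lt_trans lt1; rewrite lerDr mulr_ge0.
  by rewrite ler_nat subset_leq_card // subsetIl.
have X0 : 0 < c X by apply: le_lt_trans ltX.
have := reg sY sX; rewrite cA cB => /(_ ltY ltX); rewrite ltr_norml -/d => /andP[_].
apply/negP; rewrite -leNgt lerBrDr /density ler_pdivlMr ?mulr_gt0 // edges_betweenE.
rewrite -[in leLHS]sum1_card natr_sum mulr_suml mulr_sumr; apply: ler_sum => w.
rewrite inE mul1r => /andP[_ /ltW le1]; apply: le_trans le1.
rewrite mulrDl addrC lerD2l ler_wpM2l ?(ltW eps0) //.
by rewrite -cB ler_nat subset_leq_card.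
Qed.

(** Singletons are large enough for regularity, and a missing edge has density 0, which is off by
    [d >= eps]. *)
Lemma small_regular_complete x y : eps * N%:R < 1 -> eps <= d ->
  x \in A -> y \in B -> E x y.
Proof.
move=> lt1 ed xA yB; apply: contraT => nE.
have := @reg [set x] [set y]; rewrite !sub1set !cards1 cA cB => /(_ xA yB lt1 lt1).
rewrite /density edges_betweenE big_set1 (_ : [set y] :&: nb E x = set0); last first.
  by apply/setP => z; rewrite !inE; case: eqP => // ->; apply/negbTE.
rewrite cards0 mul0r sub0r normrN ltNge => /negP[]; apply: le_trans ed _.
exact: ler_norm.
Qed.

End Density.

(** * Graphs [H] on the vertex set of [G] *)

Section Main.
Variables (K : realType) (r : nat) (R : rel 'I_r) (d delta Delta eps : K).
Variables (N : nat) (T : finType) (V : 'I_r -> {set T}) (G : rel T).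
Hypotheses (r2 : (2 <= r)%N) (simR : simple_graph R) (d0 : 0 < d) (delta0 : 0 < delta)
  (eps0 : 0 < eps) (N0 : (0 < N)%N).
Let a := delta * d `^ Delta / (r%:R * Delta).
Hypothesis eps_small : eps < a `^ 120%:R.
Hypotheses (disV : forall i j, i != j -> [disjoint V i & V j]) (cV : forall i, #|V i| = N)
  (covV : \bigcup_i V i = [set: T]).
Hypotheses (simG : simple_graph G)
  (regG : forall i j, R i j -> super_regular_pair eps d delta G (V i) (V j))
  (subG : forall x y, G x y -> blowup R V x y).

Lemma spanning_embedding (H : rel T) : symmetric H -> 1 <= Delta -> (0 < maxdeg H)%N ->
    (maxdeg H)%:R <= Delta -> (forall x y, H x y -> blowup R V x y) ->
  exists f : T -> T, injective f /\ forall x y, H x y -> G (f x) (f y).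
Proof.
move=> symH Delta1 degH leH subH.
(* An edge of [H] yields an edge of [R], hence a super-regular pair, which forces [d <= 1] and
   [delta <= 1]. *)
have [x0 [y0 Hxy0]] : exists x y, H x y.
  have [[x y] /= Hxy|noH] := pickP (fun p => H p.1 p.2); first by exists x, y.
  move: degH; rewrite lt0n; have -> //: maxdeg H = 0%N.
  apply: big1 => x _; apply: eq_card0 => y; rewrite inE; exact: (noH (x, y)).
have [i0 [j0 Rij0]] : exists i j, R i j.
  by have /existsP[i /existsP[j /and3P[Rij _ _]]] := subH _ _ Hxy0; exists i, j.
have r0 : 0 < r%:R :> K by rewrite ltr0n; lia.
have d1 : d <= 1 by have [_ + _ _] := regG Rij0; move/le_trans; apply; exact: density_le1.
have n0 : 0 < N%:R :> K by rewrite ltr0n.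
have delta1 : delta <= 1.
  have [v vi] : exists v, v \in V i0 by apply/card_gt0P; rewrite cV.
  have [_ _ /(_ v vi) + _] := regG Rij0; rewrite cV => le1.
  rewrite -(ler_pM2r n0); apply: le_trans le1 _; rewrite mul1r ler_nat -(cV j0).
  by apply: subset_leq_card; apply/subsetP => w; rewrite inE => /andP[].
have dD0 : 0 < d `^ Delta by exact: powR_gt0.
have a0 : 0 < a by rewrite /a divr_gt0 ?mulr_gt0 //; lra.
(* Passes from the real exponent to the integer one; since [d <= 1], the smaller exponent gives the
   larger power. *)
have dDelta : d `^ Delta <= d ^+ maxdeg H.
  rewrite -powR_mulrn ?(ltW d0) //; apply: ger_powR => //; by rewrite d0 d1.
have ale : a * (r%:R * Delta) = delta * d `^ Delta.
  by rewrite /a divfK // mulf_neq0 // gt_eqF //; lra.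
have dD1 : d `^ Delta <= 1 by apply: le_trans dDelta _; rewrite exprn_ile1 // ltW.
have r2K : 2%:R <= r%:R :> K by rewrite ler_nat.
have rD2 : 2%:R <= r%:R * Delta by nra.
have a_dD : a <= d `^ Delta by clear eps_small; nra.
have a_delta : a <= delta by clear eps_small; nra.
have a_half : a <= 2%:R^-1 by clear eps_small; nra.
have a_d : a <= d.
  apply: le_trans a_dD (le_trans dDelta _); rewrite -(prednK degH) exprS ler_piMr ?(ltW d0) //.
  by rewrite exprn_ile1 // ltW.
have eps_le : eps <= a ^+ 120 by rewrite -powR_mulrn ?ltW.
have eps_d : eps <= d.
  apply: le_trans eps_le (le_trans _ a_d); rewrite exprS ler_piMr ?(ltW a0) //.
  by rewrite exprn_ile1 ?(ltW a0) //; lra.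
(* For tiny clusters all pairs are complete and the identity works; otherwise [1 <= eps * N], as the
   setting demands. *)
have [small|large] := ltP (eps * N%:R) 1.
  exists id; split=> // x y /subH /existsP[i /existsP[j /and3P[Rij xi yj]]].
  have [reg dij _ _] := regG Rij.
  exact: (small_regular_complete (cV i) (cV j) reg small (le_trans eps_d dij)).
have [cl clV] : exists cl : T -> 'I_r, forall v i, (v \in V i) = (cl v == i).
  have [cl clP] : exists cl : T -> 'I_r, forall v, v \in V (cl v).
    suff ex v : exists i, v \in V i by exact: (fin_all_exists ex).
    have : v \in \bigcup_i V i by rewrite covV inE.
    by case/bigcupP => i _ vi; exists i.
  exists cl => v i; apply/idP/eqP => [vi|<- //]; apply/eqP; apply: contraT => ne.
  by have /pred0P/(_ v) := disV ne; rewrite /= vi clP.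
have partV i : part cl i = V i by apply/setP => v; rewrite inE clV.
have blow x y : blowup R V x y -> R (cl x) (cl y).
  by case/existsP => i /existsP[j /and3P[Rij]]; rewrite !clV => /eqP-> /eqP->.
have Rirr i j : R i j -> i != j by apply: contraTneq => ->; case: simR => _ ->.
apply: (@permutation_embedding K r T cl N G H R (fun i j => density K G (V i) (V j))
  (maxdeg H) a eps d); split=> //.
- by move=> i; rewrite partV.
- by case: simG.
- by move=> v w /subG/blow/Rirr.
- by move=> x y /subH/blow/Rirr.
- by move=> x y /subH/blow.
- by move=> x; apply: (leq_bigmax x).
- by move=> i j /regG[].
- by move=> i j _; exact: density_le1.
- move=> i j A Rij; rewrite !partV => sA; have [reg _ _ _] := regG Rij.
  exact: (few_low_degree (cV i) (cV j) eps0 reg sA).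
- move=> i j A Rij; rewrite !partV => sA; have [reg _ _ _] := regG Rij.
  exact: (few_high_degree (cV i) (cV j) eps0 reg sA).
- move=> v j Rvj; rewrite partV; have [_ _ /(_ v) + _] := regG Rvj.
  rewrite clV eqxx cV => /(_ isT); rewrite setIdE => le1.
  by apply: le_trans le1; rewrite ler_wpM2r // ltW.
- exact: le_trans a_dD dDelta.
- have : r%:R * (maxdeg H)%:R * a <= r%:R * Delta * a by rewrite !ler_wpM2r ?(ltW a0) // ler_wpM2l // ltW.
  by move/le_trans; apply; rewrite mulrC ale mulr_ile1 // ltW.
Qed.

End Main.

(** * Reduction to graphs on the vertex set of [G] *)

Theorem theorem1 (K : realType) :
  exists C : K,
  forall (r : nat) (R : rel 'I_r) (d delta Delta eps : K),
    (2 <= r)%N -> simple_graph R ->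
    0 < d -> 0 < delta -> 0 < Delta ->
    0 < eps -> eps < (delta * d `^ Delta / (r%:R * Delta)) `^ C ->
  forall (N : nat) (T : finType) (V : 'I_r -> {set T}),
    (0 < N)%N ->
    (forall i j, i != j -> [disjoint V i & V j]) ->
    (forall i, #|V i| = N) ->
    \bigcup_i V i = [set: T] ->
  forall G : rel T,
    simple_graph G ->
    (forall i j, R i j -> super_regular_pair eps d delta G (V i) (V j)) ->
    (forall x y, G x y -> blowup R V x y) ->
  forall (S : finType) (H : rel S),
    simple_graph H ->
    (maxdeg H)%:R <= Delta ->
    embeddable H (blowup R V) -> embeddable H G.
Proof.
exists 120%:R => r R d delta Delta eps r2 simR d0 delta0 Delta0 eps0 epsle.
move=> N T V N0 disV cV covV G simG regG subG S H [symH irrH] degH [psi [injpsi homH]].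
(* Without edges [psi] itself is an embedding; otherwise the maximum degree is positive and
   [1 <= Delta]. *)
have [noH|someH] := posnP (maxdeg H).
  exists psi; split=> // x y Hxy; have : (#|[set z | H x z]| <= maxdeg H)%N by exact: (leq_bigmax x).
  by rewrite noH leqn0 cards_eq0 => /eqP/setP/(_ y); rewrite !inE Hxy.
(* The copy of [H] under [psi], with the remaining vertices of [T] isolated; it has the same maximum
   degree. *)
pose H' x y := [exists s, exists t, [&& psi s == x, psi t == y & H s t]].
have H'P s t : H' (psi s) (psi t) = H s t.
  apply/existsP/idP => [[s' /existsP[t' /and3P[/eqP/injpsi-> /eqP/injpsi->]]] //|Hst].
  by exists s; apply/existsP; exists t; rewrite !eqxx.
have nbH' x : #|[set y | H' x y]| = (\sum_(s | psi s == x) #|[set t | H s t]|)%N.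
  have [s /eqP <-|nox] := pickP (fun s => psi s == x); last first.
    rewrite big_pred0 //; apply: eq_card0 => y; rewrite !inE; apply/negbTE/negP.
    by move=> /existsP[s /existsP[t /and3P[]]]; rewrite nox.
  rewrite (big_pred1 s); last by move=> s'; rewrite /= (inj_eq injpsi).
  rewrite -(card_imset _ injpsi); apply: eq_card => y; rewrite inE; apply/idP/imsetP.
    case/existsP => s' /existsP[t /and3P[/eqP/injpsi-> /eqP<- Hst]].
    by exists t; rewrite ?inE.
  by case=> t; rewrite inE => Hst ->; rewrite H'P.
have deg_eq : maxdeg H' = maxdeg H.
  apply/eqP; rewrite eqn_leq; apply/andP; split; apply/bigmax_leqP => x _.
    rewrite nbH'; have [s /eqP <-|nox] := pickP (fun s => psi s == x); last by rewrite big_pred0.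
    rewrite (big_pred1 s); first exact: (leq_bigmax s).
    by move=> s'; rewrite /= (inj_eq injpsi).
  apply: leq_trans (leq_bigmax (psi x)); rewrite nbH' (big_pred1 x) //.
  by move=> s'; rewrite /= (inj_eq injpsi).
have Delta1 : 1 <= Delta by apply: le_trans degH; rewrite ler1n.
have [|||| f [injf homf]] := spanning_embedding r2 simR d0 delta0 eps0 N0 epsle disV cV covV simG
  regG subG (H := H') _ Delta1.
- move=> x y; apply/idP/idP => /existsP[s /existsP[t /and3P[e1 e2 Hst]]];
    by apply/existsP; exists t; apply/existsP; exists s; rewrite e1 e2 symH.
- by rewrite deg_eq.
- by rewrite deg_eq.
- by move=> x y /existsP[s /existsP[t /and3P[/eqP<- /eqP<-]]]; exact: homH.
exists (f \o psi); split; first exact: inj_comp.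
by move=> x y Hxy; apply: homf; rewrite H'P.
Qed.
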